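(* Let $(\tilde q,\tilde p)$ be a solution on $[t_0,t_1]$ of the rough adjoint system $$q_t-q_{t_0}=\int_{t_0}^tf(q_r)\,dr+\sigma(q_r)\,d\mathbf{Z}_r,\qquad p_{t_1}-p_t=-\int_t^{t_1}\bigg[\Big(\frac{\partial f}{\partial q}(q_r)\Big)^*p_r\,dr+\Big(\frac{\partial\sigma}{\partial q}(q_r)\Big)^*p_r\,d\mathbf{Z}_r\bigg],$$ and let $\delta\tilde q$ be the solution of the variational equation associated with $\tilde q$, $$d\,\delta q_t=\frac{\partial f}{\partial q}(\tilde q_t)\,\delta q_t\,dt+\frac{\partial\sigma}{\partial q}(\tilde q_t)\,\delta q_t\,d\mathbf{Z}_t,\qquad\delta q_{t_0}=\delta a .$$ Then $$\langle\tilde p_{t_1},\delta\tilde q_{t_1}\rangle=\langle\tilde p_{t_0},\delta\tilde q_{t_0}\rangle .$$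
   Context: Let $\alpha\in(\frac13,\frac12]$ and let $\mathbf{Z}=(Z,\mathbb{Z})$ be a fixed geometric $\alpha$-Hölder rough path on $[t_0,t_1]$ with values in $\mathbb{R}^K$ (Chen's relation and $\mathbb{Z}_{s,t}+\mathbb{Z}_{s,t}^*=Z_{s,t}\otimes Z_{s,t}$). Integrals against $\mathbf{Z}$ are rough integrals and solutions are paths controlled by $Z$ whose Gubinelli derivatives are the coefficients of $d\mathbf{Z}$. $f\in C^\infty(\mathbb{R}^N,\mathbb{R}^N)$, $\sigma\in C^\infty(\mathbb{R}^N,\mathcal{L}(\mathbb{R}^K,\mathbb{R}^N))$; $\langle\cdot,\cdot\rangle$ is the Euclidean pairing; $(\partial\sigma/\partial q)^*p\,d\mathbf{Z}$ has $i$-th component $\sum_{l,j}p_l\,\partial_{q_i}\sigma_{lj}(q)\,d\mathbf{Z}^j$, and $(\partial\sigma/\partial q)\delta q\,d\mathbf{Z}$ has $l$-th component $\sum_{i,j}\partial_{q_i}\sigma_{lj}(q)\,\delta q_i\,d\mathbf{Z}^j$. $\delta a\in\mathbb{R}^N$. *)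

(* Defs.v *)
From HB Require Import structures.
From mathcomp Require Import all_boot all_order all_algebra.
From mathcomp Require Import all_classical all_reals all_analysis.

Set Implicit Arguments.
Unset Strict Implicit.
Unset Printing Implicit Defensive.

Import Order.TTheory GRing.Theory Num.Theory.
Import numFieldNormedType.Exports.

Local Open Scope classical_set_scope.
Local Open Scope ring_scope.

(* Vectors are columns 'cV[R]_n = 'M[R]_(n, 1), and L(R^K, R^m) is 'M[R]_(m, K).
   The norm `| _ | on matrices is the library's (entrywise maximum); all norms
   being equivalent, this choice is immaterial for Hölder bounds and limits. *)

Definition dotv (R : realType) (n : nat) (x y : 'cV[R]_n) : R :=
  \sum_(i < n) x i 0 * y i 0.

Definition partial (R : realType) (n m k : nat) (i : 'I_n)
    (phi : 'cV[R]_n -> 'M[R]_(m, k)) : 'cV[R]_n -> 'M[R]_(m, k) :=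
  fun x => 'D_(delta_mx i 0) phi x.

(* C^oo: partial derivatives of all orders exist everywhere and are continuous. *)
Definition smooth (R : realType) (n m k : nat)
    (phi : 'cV[R]_n -> 'M[R]_(m, k)) : Prop :=
  forall s : seq 'I_n,
    let psi := foldr (@partial R n m k) phi s in
    continuous psi /\
    (forall (i : 'I_n) (x : 'cV[R]_n), derivable psi x (delta_mx i 0)).

(* (d phi / d q)^* p : entry (i, j) is \sum_l p_l d_{q_i} phi_{lj}(q). *)
Definition dstar (R : realType) (n k : nat)
    (phi : 'cV[R]_n -> 'M[R]_(n, k)) (q p : 'cV[R]_n) : 'M[R]_(n, k) :=
  \matrix_(i, j) \sum_(l < n) p l 0 * partial i phi q l j.

(* (d phi / d q) v : entry (l, j) is \sum_i d_{q_i} phi_{lj}(q) v_i. *)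
Definition dapp (R : realType) (n k : nat)
    (phi : 'cV[R]_n -> 'M[R]_(n, k)) (q v : 'cV[R]_n) : 'M[R]_(n, k) :=
  \matrix_(l, j) \sum_(i < n) partial i phi q l j * v i 0.

Definition incr (R : realType) (m k : nat) (X : R -> 'M[R]_(m, k)) (s t : R) :
    'M[R]_(m, k) :=
  X t - X s.

Definition holder2 (R : realType) (m k : nat) (a b gamma : R)
    (A : R -> R -> 'M[R]_(m, k)) : Prop :=
  exists C : R, forall s t : R, a <= s -> s <= t -> t <= b ->
    `|A s t| <= C * (t - s) `^ gamma.

(* ZZ s t i j stands for the iterated integral \int_s^t (Z^i_r - Z^i_s) dZ^j_r. *)
Record geometric_rough_path (R : realType) (K : nat) (alpha t0 t1 : R)
    (Z : R -> 'cV[R]_K) (ZZ : R -> R -> 'M[R]_K) : Prop := {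
  grp_holder1 : holder2 t0 t1 alpha (incr Z);
  grp_holder2 : holder2 t0 t1 (2 * alpha) ZZ;
  grp_chen : forall s u t : R, t0 <= s -> s <= u -> u <= t -> t <= t1 ->
    ZZ s t = ZZ s u + ZZ u t + incr Z s u *m (incr Z u t)^T;
  grp_geom : forall s t : R, t0 <= s -> s <= t -> t <= t1 ->
    ZZ s t + (ZZ s t)^T = incr Z s t *m (incr Z s t)^T
}.

Record controlled (R : realType) (K m : nat) (alpha t0 t1 : R)
    (Z : R -> 'cV[R]_K) (X : R -> 'cV[R]_m) (X' : R -> 'M[R]_(m, K)) : Prop := {
  ctl_path : holder2 t0 t1 alpha (incr X);
  ctl_deriv : holder2 t0 t1 alpha (incr X');
  ctl_rem : holder2 t0 t1 (2 * alpha)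
              (fun s t => incr X s t - X' s *m incr Z s t)
}.

(* Gubinelli derivative D phi(X) X' of phi(X); its value at direction k of Z is
   \sum_i d_i phi(X) X'_{ik}. *)
Definition gub_comp (R : realType) (K n m : nat)
    (phi : 'cV[R]_n -> 'M[R]_(m, K)) (X : R -> 'cV[R]_n)
    (X' : R -> 'M[R]_(n, K)) : R -> 'I_K -> 'M[R]_(m, K) :=
  fun r k => \sum_(i < n) X' r i k *: partial i phi (X r).

(* Y_u Z_{u,v} + Y'_u ZZ_{u,v}; its l-th entry is
   \sum_j Y_u(l,j) Z^j_{u,v} + \sum_{k,j} Y'_u(k)(l,j) ZZ^{kj}_{u,v}. *)
Definition compensated (R : realType) (K m : nat)
    (Z : R -> 'cV[R]_K) (ZZ : R -> R -> 'M[R]_K)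
    (Y : R -> 'M[R]_(m, K)) (Y' : R -> 'I_K -> 'M[R]_(m, K))
    (u v : R) : 'cV[R]_m :=
  Y u *m incr Z u v + \sum_(k < K) Y' u k *m (row k (ZZ u v))^T.

(* With itv_partition a b s, the partition points are those of a :: s. *)
Definition rough_sum (R : realType) (m : nat) (A : R -> R -> 'cV[R]_m)
    (a b : R) (s : seq R) : 'cV[R]_m :=
  \sum_(0 <= i < size s) A (nth b (a :: s) i) (nth b (a :: s) i.+1).

Definition mesh_lt (R : realType) (a b delta : R) (s : seq R) : Prop :=
  forall i : nat, (i < size s)%N ->
    nth b (a :: s) i.+1 - nth b (a :: s) i < delta.

(* I = \int_a^b (Y, Y') dZ, the limit of compensated sums as the mesh goes to 0. *)
Definition is_rough_integral (R : realType) (K m : nat)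
    (Z : R -> 'cV[R]_K) (ZZ : R -> R -> 'M[R]_K)
    (Y : R -> 'M[R]_(m, K)) (Y' : R -> 'I_K -> 'M[R]_(m, K))
    (a b : R) (I : 'cV[R]_m) : Prop :=
  forall eps : R, 0 < eps -> exists2 delta : R, 0 < delta &
    forall s : seq R, itv_partition a b s -> mesh_lt a b delta s ->
      `|rough_sum (compensated Z ZZ Y Y') a b s - I| < eps.

Definition time_integral (R : realType) (m : nat) (g : R -> 'cV[R]_m)
    (a b : R) : 'cV[R]_m :=
  \col_i (\int[lebesgue_measure]_(r in `[a, b]) (g r i 0)).

(* I = \int_a^b F(X_r) dr + G(X_r) dZ_r for a path X controlled by Z with
   Gubinelli derivative X'. *)
Definition is_integral_along (R : realType) (K n m : nat)
    (Z : R -> 'cV[R]_K) (ZZ : R -> R -> 'M[R]_K)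
    (F : 'cV[R]_n -> 'cV[R]_m) (G : 'cV[R]_n -> 'M[R]_(m, K))
    (X : R -> 'cV[R]_n) (X' : R -> 'M[R]_(n, K))
    (a b : R) (I : 'cV[R]_m) : Prop :=
  exists2 J : 'cV[R]_m,
    is_rough_integral Z ZZ (fun r => G (X r)) (gub_comp G X X') a b J &
    I = time_integral (fun r => F (X r)) a b + J.

(* A function of a pair (x, y), seen as a function of the stacked vector. *)
Definition on_pair (R : realType) (n m k : nat)
    (phi : 'cV[R]_n -> 'cV[R]_n -> 'M[R]_(m, k)) :
    'cV[R]_(n + n) -> 'M[R]_(m, k) :=
  fun x => phi (usubmx x) (dsubmx x).

Record adjoint_solution (R : realType) (N K : nat) (alpha t0 t1 : R)
    (Z : R -> 'cV[R]_K) (ZZ : R -> R -> 'M[R]_K)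
    (f : 'cV[R]_N -> 'cV[R]_N) (sigma : 'cV[R]_N -> 'M[R]_(N, K))
    (q p : R -> 'cV[R]_N) : Prop := {
  adj_q_controlled :
    controlled alpha t0 t1 Z q (fun r => sigma (q r));
  adj_p_controlled :
    controlled alpha t0 t1 Z p (fun r => - dstar sigma (q r) (p r));
  adj_q_eq : forall t : R, t0 <= t -> t <= t1 ->
    is_integral_along Z ZZ f sigma q (fun r => sigma (q r)) t0 t (q t - q t0);
  adj_p_eq : forall t : R, t0 <= t -> t <= t1 ->
    exists2 I : 'cV[R]_N,
      is_integral_along Z ZZ (on_pair (dstar f)) (on_pair (dstar sigma))
        (fun r => col_mx (q r) (p r))
        (fun r => col_mx (sigma (q r)) (- dstar sigma (q r) (p r)))
        t t1 I &
      p t1 - p t = - I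
}.

Record variational_solution (R : realType) (N K : nat) (alpha t0 t1 : R)
    (Z : R -> 'cV[R]_K) (ZZ : R -> R -> 'M[R]_K)
    (f : 'cV[R]_N -> 'cV[R]_N) (sigma : 'cV[R]_N -> 'M[R]_(N, K))
    (q : R -> 'cV[R]_N) (da : 'cV[R]_N) (dq : R -> 'cV[R]_N) : Prop := {
  var_controlled :
    controlled alpha t0 t1 Z dq (fun r => dapp sigma (q r) (dq r));
  var_eq : forall t : R, t0 <= t -> t <= t1 ->
    is_integral_along Z ZZ (on_pair (dapp f)) (on_pair (dapp sigma))
      (fun r => col_mx (q r) (dq r))
      (fun r => col_mx (sigma (q r)) (dapp sigma (q r) (dq r)))
      t0 t (dq t - dq t0);
  var_init : dq t0 = da
}.

(* Main.v *)
Require Import Defs.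
From mathcomp Require Import all_boot all_order all_algebra.
From mathcomp Require Import all_classical all_reals all_analysis.
From mathcomp Require Import ring lra.
Import Order.TTheory GRing.Theory Num.Theory.
Import numFieldNormedType.Exports.
Local Open Scope ring_scope.

Set Implicit Arguments.
Unset Strict Implicit.

(** The pairing [<p, dq>] is constant because its increment over [s, t] is
    O((t - s)^(3 alpha)) with 3 alpha > 1: cutting an interval into many pieces then
    shows that the total increment is 0 ([hoelder_gt1_cst]).

    To obtain this bound, the equations, which only describe integrals over [t0, t]
    or [t, t1], are localized. The defect of additivity of the compensated germ
    Y_s Z_{s,t} + Y'_s ZZ_{s,t} is O((t - s)^(3 alpha)) by Chen's relation
    ([germ_defect]), and the sewing argument along bisections turns this into
      dq_t - dq_s = F_s (t - s) + (A_s Z_{s,t} + A'_s ZZ_{s,t}) + O((t - s)^(3 alpha))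
    and a similar formula with G, B, B' and a minus sign for p
    ([local_expansion_forward], [local_expansion_backward]). Here F, A are the
    Jacobians of f and sigma applied to dq, and G, B are their adjoints applied to p.
    These expansions require the entries of A and B to be controlled by Z with
    Gubinelli derivatives A' and B'. The entries are sums of products of a partial
    derivative of sigma along q with a component of dq or p, so this follows from a
    chain rule and a Leibniz rule for scalar controlled paths ([scontrolled_comp],
    [scontrolled_dapp], [scontrolled_dstar]).

    In the increment of the pairing, the terms in t - s and in Z_{s,t} cancel because
    B and A (and G and F) are adjoint. The second-level terms do not cancel alone: the
    second derivatives of sigma do, and what is left is
      sum over i of B_{ij} A_{ik} (ZZ^{kj} + ZZ^{jk}).
    For a geometric rough path this is the product of the increments B Z and A Z, which
    is the leading part of minus the product of the increments of p and dq
    ([pairing_germ_cancels]). *)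

(** * The entrywise norm *)

Section MatrixNorm.
Variable R : realType.

Lemma mx_coord_le (m n : nat) (M : 'M[R]_(m, n)) i j : `|M i j| <= `|M|.
Proof.
rewrite [leRHS]/Num.Def.normr/= mx_normrE.
exact: (le_bigmax _ (fun ij => `|M ij.1 ij.2|) (i, j)).
Qed.

Lemma mx_norm_le (m k : nat) (M : 'M[R]_(m, k)) (c : R) : 0 <= c ->
  (forall i j, `|M i j| <= c) -> `|M| <= c.
Proof.
move=> c0 h; rewrite [leLHS]/Num.Def.normr/= mx_normrE.
by apply: bigmax_le => // ij _; exact: h.
Qed.

End MatrixNorm.

(** * Bounds on functions of two times *)

Section TwoParameterBounds.
Variables (R : realType) (a b : R).
Implicit Types (A B : R -> R -> R) (x y : R -> R) (g : R).

Definition bigO2 g A : Prop :=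
  exists C : R, forall s t : R, a <= s -> s <= t -> t <= b ->
    `|A s t| <= C * (t - s) `^ g.

Definition bounded_on x : Prop :=
  exists M : R, forall s : R, a <= s -> s <= b -> `|x s| <= M.

Definition hoelder g x : Prop := bigO2 g (fun s t => x t - x s).

Lemma eq_bigO2 g A B :
  (forall s t, a <= s -> s <= t -> t <= b -> A s t = B s t) ->
  bigO2 g A -> bigO2 g B.
Proof.
move=> AB [C hC]; exists C => s t as_ st tb.
by rewrite -AB //; exact: hC.
Qed.

Lemma bigO20 g : bigO2 g (fun _ _ => 0).
Proof. by exists 0 => s t _ _ _; rewrite normr0 mul0r. Qed.

Lemma bigO2D g A B : bigO2 g A -> bigO2 g B ->
  bigO2 g (fun s t => A s t + B s t).
Proof.
move=> [C hC] [D hD]; exists (C + D) => s t as_ st tb.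
rewrite mulrDl (le_trans (ler_normD _ _)) // lerD //; [exact: hC|exact: hD].
Qed.

Lemma bigO2N g A : bigO2 g A -> bigO2 g (fun s t => - A s t).
Proof.
move=> [C hC]; exists C => s t as_ st tb; rewrite normrN; exact: hC.
Qed.

Lemma bigO2B g A B : bigO2 g A -> bigO2 g B ->
  bigO2 g (fun s t => A s t - B s t).
Proof. by move=> hA hB; apply: bigO2D hA (bigO2N hB). Qed.

Lemma bigO2_sum (I : Type) (r : seq I) g (A : I -> R -> R -> R) :
  (forall i, bigO2 g (A i)) -> bigO2 g (fun s t => \sum_(i <- r) A i s t).
Proof.
move=> hA; elim: r => [|i r ih].
  by apply: eq_bigO2 (bigO20 g) => s t _ _ _; rewrite big_nil.
by apply: eq_bigO2 (bigO2D (hA i) ih) => s t _ _ _; rewrite big_cons.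
Qed.

Lemma bigO2M g h A B : 0 < g + h -> bigO2 g A -> bigO2 h B ->
  bigO2 (g + h) (fun s t => A s t * B s t).
Proof.
move=> gh [C hC] [D hD]; exists (C * D) => s t as_ st tb.
rewrite normrM powRD; last by rewrite gt_eqF.
by rewrite mulrACA ler_pM // ?hC ?hD.
Qed.

Lemma bigO2_weaken g h A : 0 < h -> h <= g -> bigO2 g A -> bigO2 h A.
Proof.
move=> h0 hg [C hC]; exists (`|C| * (b - a) `^ (g - h)) => s t as_ st tb.
apply: le_trans (hC s t as_ st tb) _.
apply: le_trans (ler_wpM2r (powR_ge0 _ _) (ler_norm C)) _.
rewrite -mulrA ler_wpM2l //.
have -> : (t - s) `^ g = (t - s) `^ (g - h) * (t - s) `^ h.
  by rewrite -powRD subrK // gt_eqF // (lt_le_trans h0).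
rewrite ler_wpM2r ?powR_ge0 // ge0_ler_powR ?nnegrE ?subr_ge0 //.
  by rewrite (le_trans as_) // (le_trans st).
by rewrite lerB.
Qed.

Lemma bigO2Ml g x A : bounded_on x -> bigO2 g A ->
  bigO2 g (fun s t => x s * A s t).
Proof.
move=> [M hM] [C hC]; exists (M * C) => s t as_ st tb.
rewrite normrM -mulrA ler_pM //; last exact: hC.
by apply: hM => //; exact: le_trans tb.
Qed.

Lemma hoelder_bounded g x : 0 <= g -> hoelder g x -> bounded_on x.
Proof.
move=> g0 [C hC]; exists (`|x a| + `|C| * (b - a) `^ g) => s as_ sb.
rewrite -[x s](subrK (x a)) addrC (le_trans (ler_normD _ _)) // lerD //.
apply: le_trans (hC _ _ (lexx a) as_ sb) _.
apply: le_trans (ler_wpM2r (powR_ge0 _ _) (ler_norm C)) _.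
rewrite ler_wpM2l // ge0_ler_powR ?nnegrE ?subr_ge0 ?(le_trans as_) //.
by rewrite lerB.
Qed.

Lemma hoelderM g x y : 0 < g -> hoelder g x -> hoelder g y ->
  hoelder g (fun t => x t * y t).
Proof.
move=> g0 hx hy.
have bx := hoelder_bounded (ltW g0) hx; have by_ := hoelder_bounded (ltW g0) hy.
have xy := bigO2D (bigO2D (bigO2Ml bx hy) (bigO2Ml by_ hx))
  (bigO2_weaken g0 _ (bigO2M _ hx hy)).
apply: eq_bigO2 (xy _ _) => [s t _ _ _||]; [ring| |]; lra.
Qed.

Lemma hoelder_sum (I : Type) (r : seq I) g (x : I -> R -> R) :
  (forall i, hoelder g (x i)) -> hoelder g (fun t => \sum_(i <- r) x i t).
Proof.
move=> hx; apply: eq_bigO2 (bigO2_sum r hx) => s t _ _ _.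
by rewrite -sumrB.
Qed.

End TwoParameterBounds.

Section Halving.
Local Open Scope classical_set_scope.
Local Open Scope ring_scope.
Variable (R : realType).

Lemma midpoint_ineq (s t : R) : s <= t -> s <= (s + t) / 2 <= t.
Proof. by move=> st; apply/andP; split; lra. Qed.

(** Each half of an interval carries the factor [2 `^ (- g)]; the two halves
    together carry [2 * 2 `^ (- g)], which is below 1 exactly when [1 < g]. This
    contraction drives both the constancy lemma and the sewing bound. *)
Lemma powR_half (g s t : R) : s <= t ->
  ((s + t) / 2 - s) `^ g = 2 `^ (- g) * (t - s) `^ g /\
  (t - (s + t) / 2) `^ g = 2 `^ (- g) * (t - s) `^ g.
Proof.
move=> st.
have -> : (s + t) / 2 - s = (t - s) / 2 by field.
have -> : t - (s + t) / 2 = (t - s) / 2 by field.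
rewrite powRM ?subr_ge0 // ?invr_ge0 ?ler0n // mulrC.
by rewrite -powR_inv1 // -powRrM mulN1r.
Qed.

Lemma two_powRN_lt1 (g : R) : 1 < g -> 2 * 2 `^ (- g) < 1 :> R.
Proof.
move=> g1; have -> : 2 * 2 `^ (- g) = (2 `^ (g - 1))^-1 :> R.
  rewrite -powRN -{1}[2](@powRr1 R) // -powRD ?pnatr_eq0 ?implybT //.
  by congr powR; ring.
have : 1 `^ (g - 1) < 2 `^ (g - 1) by rewrite gt0_ltr_powR ?nnegrE //; lra.
by rewrite powR1 => h; rewrite invf_lt1 // (lt_trans ltr01).
Qed.

(** Halving [n] times multiplies the Hölder bound on the total increment by
    [(2 * 2 `^ (- g)) ^+ n], which tends to 0. *)
Lemma hoelder_gt1_cst (a b g : R) (x : R -> R) : a <= b -> 1 < g ->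
  hoelder a b g x -> x b = x a.
Proof.
move=> ab g1 [C hC].
set r : R := 2 * 2 `^ (- g).
have r1 : r < 1 := two_powRN_lt1 g1.
have r0 : 0 <= r by rewrite mulr_ge0 ?powR_ge0.
have h n : forall s t, a <= s -> s <= t -> t <= b ->
    `|x t - x s| <= r ^+ n * (C * (t - s) `^ g).
  elim: n => [|n ih] s t as_ st tb; first by rewrite expr0 mul1r; exact: hC.
  have /andP[sm mt] := midpoint_ineq st.
  have -> : x t - x s = (x ((s + t) / 2) - x s) + (x t - x ((s + t) / 2)) by ring.
  apply: le_trans (ler_normD _ _) _.
  have h1 := ih _ _ as_ sm (le_trans mt tb).
  have h2 := ih _ _ (le_trans as_ sm) mt tb.
  have [e1 e2] := powR_half g st.
  rewrite e1 in h1; rewrite e2 in h2.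
  apply: le_trans (lerD h1 h2) _.
  rewrite le_eqVlt; apply/orP; left; apply/eqP.
  by rewrite exprS /r; ring.
apply/eqP; rewrite -subr_eq0 -normr_le0.
set c := C * (b - a) `^ g in h *.
have cv : (fun n => r ^+ n * c) @ \oo --> (0 : R).
  rewrite -(mul0r c); apply: cvgMl; apply: cvg_expr; rewrite ger0_norm //.
rewrite -(cvg_lim (@Rhausdorff R) cv); apply: limr_ge.
  by apply/cvg_ex; exists 0.
by apply: nearW => n; exact: (h n).
Qed.

End Halving.

(** * Sewing along bisections *)

Section Sewing.
Variable (R : realType).
Implicit Types (A : R -> R -> R) (P : seq R).

(** Recursion on the list of partition points makes concatenation of partitions
    computational; [rough_sum_coord] below identifies this sum with the indexed
    one. *)
Fixpoint rsum A (u : R) P : R :=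
  if P is v :: P' then A u v + rsum A v P' else 0.

Definition fine_partition (u v d : R) P : Prop :=
  itv_partition u v P /\ path (fun x y => y - x < d) u P.

Definition sum_limit A (u v I : R) : Prop :=
  forall eps : R, 0 < eps -> exists2 d : R, 0 < d &
    forall P, fine_partition u v d P -> `|rsum A u P - I| < eps.

Lemma rsum_cat A u P Q : rsum A u (P ++ Q) = rsum A u P + rsum A (last u P) Q.
Proof. by elim: P u => [|v P ih] u /=; rewrite ?add0r // ih addrA. Qed.

Lemma fine_partition_cat u v w d P Q :
  fine_partition u v d P -> fine_partition v w d Q ->
  fine_partition u w d (P ++ Q).
Proof.
move=> [uv mP] [vw mQ]; split; first exact: itv_partition_cat uv vw.
by case: uv => _ /eqP uv; rewrite cat_path mP uv.
Qed.

Lemma fine_partition_last u v d P : fine_partition u v d P -> last u P = v.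
Proof. by case=> -[_ /eqP]. Qed.

Lemma fine_partition_weaken u v d d' P : d <= d' ->
  fine_partition u v d P -> fine_partition u v d' P.
Proof.
move=> dd' [uv mP]; split=> //; apply: sub_path mP => x y /= xy.
exact: lt_le_trans dd'.
Qed.

Variables (a b th C : R).
Hypothesis (th1 : 1 < th).

(** The fixed point of [D = 2 * 2 `^ (- th) * D + C]: the defect [C] of one bisection
    plus the errors already made on the two halves. *)
Definition sewing_cst : R := C / (1 - 2 * 2 `^ (- th)).

Variable A : R -> R -> R.
Hypothesis defect : forall s u t, a <= s -> s <= u -> u <= t -> t <= b ->
  `|A s t - A s u - A u t| <= C * (t - s) `^ th.

(** Bisecting [s, t] repeatedly gives partitions as fine as desired, and the
    errors on the two halves together with the defect of the bisection reproduce
    the bound with the same constant. A limit that exists can be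
    computed along these partitions. *)
Lemma fine_partition_close s t d : a <= s -> s <= t -> t <= b -> 0 < d ->
  exists2 P, fine_partition s t d P &
    `|rsum A s P - A s t| <= sewing_cst * (t - s) `^ th.
Proof.
move=> as_ st tb d0.
have th0 : th != 0 by rewrite gt_eqF // (lt_trans ltr01).
have [ts|{}st] := leP t s.
  have <- : s = t by apply/eqP; rewrite eq_le st.
  exists [::]; first by split => //; split=> //=.
  have := defect as_ (lexx s) (lexx s) (le_trans st tb).
  by rewrite !subrr powR0 // !mulr0.
(* n bisections bring the mesh below d *)
have [n dn] : exists n, (t - s) / 2 ^+ n < d.
  have := @archi_boundP R ((t - s) / d); set n := Num.bound _.
  move=> /(_ (divr_ge0 (ltW _) (ltW d0))); rewrite subr_gt0 => /(_ st) h.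
  exists n; rewrite ltr_pdivrMr ?exprn_gt0 // mulrC -ltr_pdivrMr //.
  apply: lt_le_trans h _; rewrite -natrX ler_nat.
  by rewrite ltnW // ltn_expl.
elim: n s t as_ st tb dn => [|n ih] s t as_ st tb dn.
  exists [:: t]; first by split; [exact: itv_partition1|rewrite /= -[t - s]divr1 dn].
  rewrite /= addr0 subrr normr0 mulr_ge0 ?powR_ge0 //.
  apply: divr_ge0; last by rewrite subr_ge0 ltW // two_powRN_lt1.
  have := defect as_ (lexx s) (ltW st) tb.
  have : 0 < (t - s) `^ th by rewrite powR_gt0 // subr_gt0.
  move=> p0 /(le_trans (normr_ge0 _)).
  by rewrite pmulr_lge0.
set m := (s + t) / 2.
have sm : s < m by rewrite /m; lra.
have mt : m < t by rewrite /m; lra.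
have dm : (m - s) / 2 ^+ n < d /\ (t - m) / 2 ^+ n < d.
  have n0 : 2 ^+ n != 0 :> R by rewrite expf_neq0 ?pnatr_eq0.
  by split; apply: le_lt_trans dn; rewrite exprS /m le_eqVlt; apply/orP; left;
    apply/eqP; field.
have [P hP cP] := ih s m as_ sm (le_trans (ltW mt) tb) dm.1.
have [Q hQ cQ] := ih m t (le_trans as_ (ltW sm)) mt tb dm.2.
exists (P ++ Q); first exact: fine_partition_cat hQ.
rewrite rsum_cat (fine_partition_last hP).
have [e1 e2] := powR_half th (ltW st).
rewrite -/m in e1 e2; rewrite e1 in cP; rewrite e2 in cQ.
have D := defect as_ (ltW sm) (ltW mt) tb.
have -> : rsum A s P + rsum A m Q - A s t = (rsum A s P - A s m) +
  (rsum A m Q - A m t) - (A s t - A s m - A m t) by ring.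
apply: le_trans (ler_normB _ _) _.
apply: le_trans (lerD (le_trans (ler_normD _ _) (lerD cP cQ)) D) _.
rewrite le_eqVlt; apply/orP; left; apply/eqP; rewrite /sewing_cst.
have : 1 - 2 * 2 `^ (- th) != 0 by rewrite gt_eqF // subr_gt0 two_powRN_lt1.
move=> nz; field; exact: nz.
Qed.

(** The limit over [a, t] may be computed along partitions that contain [s] and
    restrict to the one of [fine_partition_close] on [s, t]; this gives additivity
    of the limit and the estimate on [s, t] at once, with a constant that does
    not depend on [s] and [t]. *)
Lemma sewing_bound_forward s t I J : a <= s -> s <= t -> t <= b ->
  sum_limit A a s I -> sum_limit A a t J ->
  `|J - I - A s t| <= sewing_cst * (t - s) `^ th.
Proof.
move=> as_ st tb hI hJ; apply/ler_addgt0Pr => e e0.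
have e20 : 0 < e / 2 by rewrite divr_gt0.
have [d1 d10 h1] := hI _ e20; have [d2 d20 h2] := hJ _ e20.
have d0 : 0 < Num.min d1 d2 by rewrite lt_min d10.
have m1 : Num.min d1 d2 <= d1 by rewrite ge_min lexx.
have m2 : Num.min d1 d2 <= d2 by rewrite ge_min lexx orbT.
have [P hP _] := fine_partition_close (lexx a) as_ (le_trans st tb) d0.
have [Q hQ cQ] := fine_partition_close as_ st tb d0.
have := h2 _ (fine_partition_weaken m2 (fine_partition_cat hP hQ)).
have := h1 _ (fine_partition_weaken m1 hP).
rewrite rsum_cat (fine_partition_last hP) => k1 k2.
have -> : J - I - A s t = (rsum A a P - I) - (rsum A a P + rsum A s Q - J) +
  (rsum A s Q - A s t) by ring.
apply: le_trans (ler_normD _ _) _; rewrite addrC lerD //.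
apply: le_trans (ler_normB _ _) _; rewrite [leRHS]splitr lerD //; exact: ltW.
Qed.

(** Mirror image of [sewing_bound_forward], for limits up to the right end point;
    the adjoint equation is posed backwards in time. *)
Lemma sewing_bound_backward s t I J : a <= s -> s <= t -> t <= b ->
  sum_limit A s b I -> sum_limit A t b J ->
  `|I - J - A s t| <= sewing_cst * (t - s) `^ th.
Proof.
move=> as_ st tb hI hJ; apply/ler_addgt0Pr => e e0.
have e20 : 0 < e / 2 by rewrite divr_gt0.
have [d1 d10 h1] := hI _ e20; have [d2 d20 h2] := hJ _ e20.
have d0 : 0 < Num.min d1 d2 by rewrite lt_min d10.
have m1 : Num.min d1 d2 <= d1 by rewrite ge_min lexx.
have m2 : Num.min d1 d2 <= d2 by rewrite ge_min lexx orbT.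
have [P hP _] := fine_partition_close (le_trans as_ st) tb (lexx b) d0.
have [Q hQ cQ] := fine_partition_close as_ st tb d0.
have := h1 _ (fine_partition_weaken m1 (fine_partition_cat hQ hP)).
have := h2 _ (fine_partition_weaken m2 hP).
rewrite rsum_cat (fine_partition_last hQ) => k1 k2.
have -> : I - J - A s t = (rsum A t P - J) - (rsum A s Q + rsum A t P - I) +
  (rsum A s Q - A s t) by ring.
apply: le_trans (ler_normD _ _) _; rewrite addrC lerD //.
apply: le_trans (ler_normB _ _) _; rewrite [leRHS]splitr lerD //; exact: ltW.
Qed.

End Sewing.

Section RoughSums.
Variables (R : realType).

Lemma rough_sum_coord (m : nat) (B : R -> R -> 'cV[R]_m) (a b : R) (P : seq R) l :
  rough_sum B a b P l 0 = rsum (fun u v => B u v l 0) a P.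
Proof.
rewrite /rough_sum; elim: P a => [|v P ih] a; first by rewrite /= big_geq // mxE.
by rewrite /= big_nat_recl //= mxE -ih.
Qed.

Lemma is_rough_integral_coord (K m : nat) (Z : R -> 'cV[R]_K)
    (ZZ : R -> R -> 'M[R]_K) (Y : R -> 'M[R]_(m, K))
    (Y' : R -> 'I_K -> 'M[R]_(m, K)) (a b : R) (I : 'cV[R]_m) l :
  is_rough_integral Z ZZ Y Y' a b I ->
  sum_limit (fun u v => compensated Z ZZ Y Y' u v l 0) a b (I l 0).
Proof.
move=> hI e e0; have [d d0 h] := hI e e0; exists d => // P [Pab Pd].
rewrite -(rough_sum_coord _ _ b).
have := h P Pab; set M := _ - I => hM.
have -> : rough_sum (compensated Z ZZ Y Y') a b P l 0 - I l 0 = M l 0.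
  by rewrite /M !mxE.
apply: le_lt_trans (mx_coord_le M l 0) (hM _).
by move=> i iP; have /pathP/(_ i iP) := Pd; apply.
Qed.

End RoughSums.

(** * Taylor estimates from coordinate derivatives *)

Section CoordinatewiseTaylor.
Local Open Scope classical_set_scope.
Local Open Scope ring_scope.
Variables (R : realType) (n : nat).
Implicit Types (phi : 'cV[R]_n -> R) (x y : 'cV[R]_n).

(** Derivatives along the coordinate vectors only: this is what [smooth] provides,
    and with continuity it yields the Taylor estimates. *)
Definition has_partials phi (dphi : 'I_n -> 'cV[R]_n -> R) : Prop :=
  forall i x, is_derive x (delta_mx i 0 : 'cV[R]_n) phi (dphi i x).

Lemma is_derive_line phi i x (dphi : 'cV[R]_n -> R) (h : R) :
  (forall x, is_derive x (delta_mx i 0 : 'cV[R]_n) phi (dphi x)) ->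
  is_derive h (1 : R) (fun r : R => phi (r *: delta_mx i 0 + x))
    (dphi (h *: delta_mx i 0 + x)).
Proof.
move=> hphi; have [df ef] := hphi (h *: delta_mx i 0 + x).
have E : (fun r : R => r^-1 *: (((fun r : R => phi (r *: delta_mx i 0 + x)) \o
    shift h) (r *: 1) - phi (h *: delta_mx i 0 + x))) =
  (fun r : R => r^-1 *: ((phi \o shift (h *: delta_mx i 0 + x))
    (r *: delta_mx i 0) - phi (h *: delta_mx i 0 + x))).
  by apply/funext => r /=; rewrite [_%:A]mulr1 scalerDl addrA.
split; first by rewrite /derivable E.
by rewrite /derive E.
Qed.

(** The increment [h] may have either sign, so the intermediate point is given as a
    fraction of [h]. *)
Lemma mean_value_coord phi i x (dphi : 'cV[R]_n -> R) (h : R) :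
  (forall x, is_derive x (delta_mx i 0 : 'cV[R]_n) phi (dphi x)) ->
  exists2 c : R, exists2 r : R, 0 <= r <= 1 & c = r * h &
  phi (h *: delta_mx i 0 + x) - phi x = dphi (c *: delta_mx i 0 + x) * h.
Proof.
move=> hphi; set g := fun r : R => phi (r *: delta_mx i 0 + x).
have g0 : phi x = g 0 by rewrite /g scale0r add0r.
have dg r : is_derive r (1 : R) g (dphi (r *: delta_mx i 0 + x)).
  exact: is_derive_line.
have cg u v : {within `[u, v], continuous g}.
  by apply: derivable_within_continuous => r _; have [] := dg r.
have [h0|h0] := leP 0 h.
  have [c cI e] := MVT_segment h0 (fun r _ => dg r) (cg 0 h).
  exists c; last by rewrite g0 e subr0.
  move: cI; rewrite in_itv /= => /andP[c0 ch].
  have [hz|hz] := eqVneq h 0.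
    exists 0; first by rewrite lexx ler01.
    by apply/eqP; rewrite mul0r eq_le c0 andbT -hz.
  exists (c / h); last by rewrite divfK.
  by rewrite divr_ge0 // ler_pdivrMr ?mul1r // lt_neqAle eq_sym hz.
have [c cI e] := MVT_segment (ltW h0) (fun r _ => dg r) (cg h 0).
exists c; last by rewrite g0 -[LHS]opprB e; ring.
move: cI; rewrite in_itv /= => /andP[c0 ch].
exists (c / h); last by rewrite divfK // lt_eqF.
by rewrite ler_ndivrMr // mul1r c0 andbT nmulr_lge0 ?invr_lt0.
Qed.

(** The vertices of the coordinatewise path from [x] to [y]. *)
Definition splice x y (k : nat) : 'cV[R]_n :=
  \col_j (if (j < k)%N then y j 0 else x j 0).

(** Moving from [x] to [y] one coordinate at a time and applying the
    one-dimensional mean value theorem on each edge. The intermediate points differ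
    from edge to edge but stay in the box spanned by [x] and [y], so a bound on a
    ball, or a Lipschitz estimate around [x], applies to all of them. *)
Lemma mean_value phi dphi x y : has_partials phi dphi ->
  exists2 c : 'I_n -> 'cV[R]_n,
    forall i, `|c i| <= Num.max `|x| `|y| /\ `|c i - x| <= `|y - x| &
    phi y - phi x = \sum_i dphi i (c i) * (y i 0 - x i 0).
Proof.
move=> hphi.
have step (i : 'I_n) :
    splice x y i.+1 = (y i 0 - x i 0) *: delta_mx i 0 + splice x y i.
  apply/colP => j; rewrite !mxE eqxx andbT ltnS leq_eqVlt.
  have [->|ji] := eqVneq j i; first by rewrite eqxx ltnn /= mulr1; ring.
  by rewrite (negbTE (_ : nat_of_ord j != i)) // mulr0 add0r.
have /choice[r hr] (i : 'I_n) : exists r : R, 0 <= r <= 1 /\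
    phi (splice x y i.+1) - phi (splice x y i) =
    dphi i ((r * (y i 0 - x i 0)) *: delta_mx i 0 + splice x y i) *
      (y i 0 - x i 0).
  rewrite step.
  have [_ [r r01 ->] e] := mean_value_coord (splice x y i) (y i 0 - x i 0) (hphi i).
  by exists r.
exists (fun i => (r i * (y i 0 - x i 0)) *: delta_mx i 0 + splice x y i).
  move=> i; have [/andP[r0 r1] _] := hr i.
  split; apply: mx_norm_le.
  - by rewrite le_max normr_ge0.
  - move=> j k; rewrite ord1 !mxE eqxx andbT.
    have bx := mx_coord_le x j 0; have by_ := mx_coord_le y j 0.
    have [->|ji] := eqVneq j i.
      rewrite ltnn mulr1.
      have -> : r i * (y i 0 - x i 0) + x i 0 =
        r i * y i 0 + (1 - r i) * x i 0 by ring.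
      apply: le_trans (ler_normD _ _) _.
      rewrite !normrM (ger0_norm r0) (@ger0_norm _ (1 - r i)) ?subr_ge0 //.
      have -> : Num.max `|x| `|y| =
        r i * Num.max `|x| `|y| + (1 - r i) * Num.max `|x| `|y| by ring.
      have := mx_coord_le x i 0; have := mx_coord_le y i 0 => yi xi.
      by apply: lerD; apply: ler_wpM2l; rewrite ?subr_ge0 // le_max ?yi ?xi ?orbT.
    rewrite mulr0 add0r le_max; case: ifP => _; first by rewrite by_ orbT.
    by rewrite bx.
  - exact: normr_ge0.
  - move=> j k; rewrite ord1 !mxE eqxx andbT.
    have := mx_coord_le (y - x) j 0; rewrite !mxE => yx.
    have [ji|ji] := eqVneq j i.
      rewrite ji ltnn mulr1 addrK normrM (ger0_norm r0).
      by rewrite -ji in r0 r1 *; apply: le_trans yx; rewrite ler_piMl.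
    by rewrite mulr0 add0r; case: ifP => _ //; rewrite subrr normr0.
have -> : phi y - phi x = \sum_(0 <= k < n)
    (phi (splice x y k.+1) - phi (splice x y k)).
  rewrite telescope_sumr //; congr (phi _ - phi _); apply/colP => j.
    by rewrite mxE ltn_ord.
  by rewrite mxE.
by rewrite big_mkord; apply: eq_bigr => i _; have [_ ->] := hr i.
Qed.

Lemma trmx_continuous (m k : nat) : continuous (@trmx R m k).
Proof.
move=> M A [P MP PA]; exists (fun i j => P j i) => [i j|N NP].
  by have := MP j i; rewrite mxE.
by apply: PA => i j; rewrite mxE.
Qed.

(** A box is a product of segments, hence compact in the space of row vectors;
    transposition carries this over to columns. *)
Lemma continuous_bounded_on_ball phi (c : R) : continuous phi ->
  exists M : R, forall x, `|x| <= c -> `|phi x| <= M.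
Proof.
move=> cphi.
have cpt : compact [set v : 'rV[R]_n | forall i, `[(- c), c]%classic (v ord0 i)].
  by apply: (@rV_compact R n (fun=> `[(- c), c]%classic)) => _; exact: segment_compact.
have ct : {within [set v : 'rV[R]_n | forall i, `[(- c), c]%classic (v ord0 i)],
    continuous (phi \o trmx)}.
  apply: continuous_subspaceT => v.
  by apply: continuous_comp; [exact: trmx_continuous|exact: cphi].
have /compact_bounded[M [_ hM]] := continuous_compact ct cpt.
exists (M + 1) => x xc; apply: (hM (M + 1)); first by rewrite ltrDl.
exists x^T; last by rewrite /= trmxK.
move=> i; rewrite /= in_itv /= mxE -ler_norml.
exact: le_trans (mx_coord_le x i 0) xc.
Qed.

Lemma fam_bounded_on_ball (m : nat) (F : 'I_m -> 'cV[R]_n -> R) (c : R) :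
  (forall i, continuous (F i)) ->
  exists2 M : R, 0 <= M & forall i x, `|x| <= c -> `|F i x| <= M.
Proof.
move=> cF; have /choice[M hM] i := continuous_bounded_on_ball c (cF i).
exists (\sum_i `|M i|); first exact: sumr_ge0.
move=> i x xc; apply: le_trans (hM i x xc) _; apply: le_trans (ler_norm _) _.
by rewrite (bigD1 i) //= lerDl sumr_ge0.
Qed.

Lemma lipschitz_on_ball phi dphi (c : R) :
  has_partials phi dphi -> (forall i, continuous (dphi i)) ->
  exists2 L : R, 0 <= L &
    forall x y, `|x| <= c -> `|y| <= c -> `|phi y - phi x| <= L * `|y - x|.
Proof.
move=> hphi cphi; have [M M0 hM] := fam_bounded_on_ball c cphi.
exists (n%:R * M); first by rewrite mulr_ge0.
move=> x y xc yc; have [z hz ->] := mean_value x y hphi.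
apply: le_trans (ler_norm_sum _ _ _) _.
have -> : n%:R * M * `|y - x| = \sum_(i < n) M * `|y - x|.
  by rewrite sumr_const card_ord -[RHS]mulr_natl mulrA.
apply: ler_sum => i _; rewrite normrM ler_pM //.
  apply: hM; apply: le_trans (hz i).1 _.
  by rewrite ge_max xc yc.
by have := mx_coord_le (y - x) i 0; rewrite !mxE.
Qed.

(** By [mean_value] the remainder is a sum of increments of the first partial
    derivatives times increments of coordinates; the former are Lipschitz. *)
Lemma taylor2_on_ball phi dphi (ddphi : 'I_n -> 'I_n -> 'cV[R]_n -> R) (c : R) :
  has_partials phi dphi -> (forall i, has_partials (dphi i) (ddphi i)) ->
  (forall i j, continuous (ddphi i j)) ->
  exists2 L : R, 0 <= L & forall x y, `|x| <= c -> `|y| <= c ->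
    `|phi y - phi x - \sum_i dphi i x * (y i 0 - x i 0)| <= L * `|y - x| ^+ 2.
Proof.
move=> hphi hdphi cphi.
have /choice[L hL] i : exists L : R, 0 <= L /\
    forall x y, `|x| <= c -> `|y| <= c -> `|dphi i y - dphi i x| <= L * `|y - x|.
  by have [L L0 hL] := lipschitz_on_ball c (hdphi i) (cphi i); exists L.
exists (\sum_i L i); first by apply: sumr_ge0 => i _; exact: (hL i).1.
move=> x y xc yc; have [z hz ->] := mean_value x y hphi.
rewrite -sumrB; apply: le_trans (ler_norm_sum _ _ _) _.
rewrite mulr_suml; apply: ler_sum => i _.
rewrite -mulrBl normrM expr2 mulrA ler_pM //; last first.
  by have := mx_coord_le (y - x) i 0; rewrite !mxE.
have zc : `|z i| <= c by apply: le_trans (hz i).1 _; rewrite ge_max xc yc.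
apply: le_trans ((hL i).2 x _ xc zc) _.
by rewrite ler_wpM2l ?(hL i).1 // (hz i).2.
Qed.

End CoordinatewiseTaylor.

(** * Scalar paths controlled by a rough path *)

Section ScalarControlledPaths.
Variables (R : realType) (K : nat) (a b al : R) (Z : R -> 'cV[R]_K).
Hypothesis al0 : 0 < al.
Implicit Types x y : R -> R.
Local Notation z s t k := (Z t k 0 - Z s k 0).

Lemma bigO2_le g (A B : R -> R -> R) :
  (forall s t, a <= s -> s <= t -> t <= b -> `|A s t| <= `|B s t|) ->
  bigO2 a b g B -> bigO2 a b g A.
Proof.
move=> AB [C hC]; exists C => s t as_ st tb.
by apply: le_trans (AB _ _ _ _ _) (hC _ _ _ _ _).
Qed.

Lemma bigO2_mx g (m k : nat) (M : R -> R -> 'M[R]_(m, k)) :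
  (forall i j, bigO2 a b g (fun s t => M s t i j)) <->
  bigO2 a b g (fun s t => `|M s t|).
Proof.
split=> [h|h i j]; last first.
  by apply: bigO2_le h => s t _ _ _; rewrite normr_id; exact: mx_coord_le.
have h' i j : bigO2 a b g (fun s t => `|M s t i j|).
  by apply: bigO2_le (h i j) => s t _ _ _; rewrite normr_id.
apply: bigO2_le (bigO2_sum (index_enum 'I_m)
  (fun i => bigO2_sum (index_enum 'I_k) (h' i))) => s t _ _ _.
rewrite normr_id; apply: mx_norm_le => [|i j]; first exact: normr_ge0.
rewrite [leRHS]ger0_norm; last by apply: sumr_ge0 => ? _; exact: sumr_ge0.
rewrite (bigD1 i) //= (bigD1 j) //= -addrA lerDl addr_ge0 ?sumr_ge0 // => ? _.
exact: sumr_ge0.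
Qed.

Lemma holder2_bigO2 g (m k : nat) (M : R -> R -> 'M[R]_(m, k)) :
  holder2 a b g M -> forall i j, bigO2 a b g (fun s t => M s t i j).
Proof.
move=> [C hC]; apply/bigO2_mx; exists C => s t as_ st tb.
by rewrite normr_id; exact: hC.
Qed.

(** Scalar version of [controlled]; [x' r k] is the Gubinelli derivative of [x] at
    time [r] in the direction of the [k]-th component of [Z]. Working entry by entry
    turns the linearized coefficients into sums of products of such paths. *)
Definition scontrolled x (x' : R -> 'I_K -> R) : Prop :=
  [/\ hoelder a b al x,
      forall k, hoelder a b al (fun r => x' r k) &
      bigO2 a b (2 * al) (fun s t => x t - x s - \sum_k x' s k * z s t k)].

Lemma eq_scontrolled x (x' y' : R -> 'I_K -> R) :
  (forall r k, x' r k = y' r k) -> scontrolled x x' -> scontrolled x y'.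
Proof.
move=> e [h1 h2 h3]; split=> // [k|].
  by apply: eq_bigO2 (h2 k) => s t _ _ _; rewrite !e.
by apply: eq_bigO2 h3 => s t _ _ _; under eq_bigr do rewrite e.
Qed.

Lemma controlled_coord (m : nat) (X : R -> 'cV[R]_m) (X' : R -> 'M[R]_(m, K)) i :
  controlled al a b Z X X' ->
  scontrolled (fun r => X r i 0) (fun r k => X' r i k).
Proof.
move=> [h1 h2 h3]; split=> [|k|].
- by apply: eq_bigO2 (holder2_bigO2 h1 i 0) => s t _ _ _; rewrite !mxE.
- by apply: eq_bigO2 (holder2_bigO2 h2 i k) => s t _ _ _; rewrite !mxE.
- apply: eq_bigO2 (holder2_bigO2 h3 i 0) => s t _ _ _; rewrite !mxE.
  by congr (_ - _); apply: eq_bigr => k _; rewrite !mxE.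
Qed.

Lemma scontrolled_sum (I : Type) (r : seq I) (x : I -> R -> R)
    (x' : I -> R -> 'I_K -> R) :
  (forall i, scontrolled (x i) (x' i)) ->
  scontrolled (fun t => \sum_(i <- r) x i t)
    (fun t k => \sum_(i <- r) x' i t k).
Proof.
move=> h; split=> [|k|].
- by apply: hoelder_sum => i; have [] := h i.
- by apply: hoelder_sum => i; have [_ /(_ k)] := h i.
- have hr i : bigO2 a b (2 * al) (fun s t => x i t - x i s -
      \sum_k x' i s k * z s t k) by have [] := h i.
  apply: eq_bigO2 (bigO2_sum r hr).
  move=> s t _ _ _ /=. rewrite !sumrB; congr (_ - _).
  by rewrite exchange_big; apply: eq_bigr => k _; rewrite mulr_suml.
Qed.

(** Leibniz rule: the product of the two increments is of order [2 * al] and goes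
    into the remainder. *)
Lemma scontrolledM x y (x' y' : R -> 'I_K -> R) : scontrolled x x' -> scontrolled y y' ->
  scontrolled (fun t => x t * y t) (fun t k => x' t k * y t + x t * y' t k).
Proof.
move=> [hx hx' hxr] [hy hy' hyr].
have bx := hoelder_bounded (ltW al0) hx; have by_ := hoelder_bounded (ltW al0) hy.
split=> [|k|]; first exact: hoelderM.
  apply: eq_bigO2 (bigO2D (hoelderM al0 (hx' k) hy) (hoelderM al0 hx (hy' k))).
  by move=> s t _ _ _; ring.
have xy : bigO2 a b (2 * al) (fun s t => (x t - x s) * (y t - y s)).
  rewrite (_ : 2 * al = al + al); last by ring.
  by apply: bigO2M => //; rewrite addr_gt0.
apply: eq_bigO2 (bigO2D (bigO2D (bigO2Ml bx hyr) (bigO2Ml by_ hxr)) xy).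
move=> s t _ _ _.
have -> : \sum_k (x' s k * y s + x s * y' s k) * z s t k =
    y s * (\sum_k x' s k * z s t k) + x s * (\sum_k y' s k * z s t k).
  by rewrite !mulr_sumr -big_split /=; apply: eq_bigr => k _; ring.
ring.
Qed.

Section Composition.
Variables (n : nat) (X : R -> 'cV[R]_n) (X' : R -> 'M[R]_(n, K)).
Hypothesis hX : forall i, scontrolled (fun r => X r i 0) (fun r k => X' r i k).

Lemma path_increment : bigO2 a b al (fun s t => `|X t - X s|).
Proof.
apply/bigO2_mx => i j; rewrite ord1; have [h _ _] := hX i.
by apply: eq_bigO2 h => s t _ _ _; rewrite !mxE.
Qed.

Lemma path_bounded : exists c : R, forall s, a <= s -> s <= b -> `|X s| <= c.
Proof.
have [C hC] := path_increment.
exists (`|X a| + `|C| * (b - a) `^ al) => s as_ sb.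
rewrite -[X s](subrK (X a)) addrC (le_trans (ler_normD _ _)) // lerD //.
have := hC _ _ (lexx a) as_ sb; rewrite normr_id => /le_trans; apply.
apply: le_trans (ler_wpM2r (powR_ge0 _ _) (ler_norm C)) _.
rewrite ler_wpM2l // ge0_ler_powR ?nnegrE ?subr_ge0 ?(le_trans as_) ?(ltW al0) //.
by rewrite lerB.
Qed.

Variables (phi : 'cV[R]_n -> R) (dphi : 'I_n -> 'cV[R]_n -> R).
Hypotheses (hphi : has_partials phi dphi) (cdphi : forall i, continuous (dphi i)).

Lemma hoelder_comp : hoelder a b al (fun r => phi (X r)).
Proof.
have [c hc] := path_bounded; have [L L0 hL] := lipschitz_on_ball c hphi cdphi.
have [C hC] := path_increment.
exists (L * C) => s t as_ st tb.
apply: le_trans (hL _ _ (hc _ as_ (le_trans st tb)) (hc _ (le_trans as_ st) tb)) _.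
by rewrite -mulrA ler_wpM2l // -[`|_|]normr_id; exact: hC.
Qed.

End Composition.

(** The second-order Taylor remainder is quadratic in an increment of order [al],
    and the linear term inherits the remainder of [X]. *)
Lemma scontrolled_comp (n : nat) (X : R -> 'cV[R]_n) (X' : R -> 'M[R]_(n, K))
    phi dphi (ddphi : 'I_n -> 'I_n -> 'cV[R]_n -> R) :
  (forall i, scontrolled (fun r => X r i 0) (fun r k => X' r i k)) ->
  has_partials phi dphi -> (forall i, continuous (dphi i)) ->
  (forall i, has_partials (dphi i) (ddphi i)) ->
  (forall i j, continuous (ddphi i j)) ->
  scontrolled (fun r => phi (X r)) (fun r k => \sum_i dphi i (X r) * X' r i k).
Proof.
move=> hX hphi cphi hdphi cdphi.
have hd i : hoelder a b al (fun r => dphi i (X r)).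
  exact (hoelder_comp hX (hdphi i) (cdphi i)).
split=> [|k|]; first exact (hoelder_comp hX hphi cphi).
  by apply: hoelder_sum => i; apply: hoelderM => //; have [_] := hX i.
have [c hc] := path_bounded hX.
have [L L0 hL] := taylor2_on_ball c hphi hdphi cdphi.
have quad : bigO2 a b (2 * al) (fun s t => phi (X t) - phi (X s) -
    \sum_i dphi i (X s) * (X t i 0 - X s i 0)).
  have inc := path_increment hX.
  have bL : bounded_on a b (fun=> L) by exists L => *; rewrite ger0_norm.
  have al2 : 0 < al + al by rewrite addr_gt0.
  have := bigO2Ml bL (bigO2M al2 inc inc).
  rewrite (_ : al + al = 2 * al); last by ring.
  apply: bigO2_le => s t as_ st tb.
  apply: le_trans (hL _ _ (hc _ as_ (le_trans st tb)) (hc _ (le_trans as_ st) tb)) _.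
  by rewrite -expr2 ger0_norm // mulr_ge0 // sqr_ge0.
have lin i : bigO2 a b (2 * al) (fun s t => dphi i (X s) *
    (X t i 0 - X s i 0 - \sum_k X' s i k * z s t k)).
  by apply: bigO2Ml (hoelder_bounded (ltW al0) (hd i)) _; have [] := hX i.
apply: eq_bigO2 (bigO2D quad (bigO2_sum (index_enum 'I_n) lin)).
move=> s t _ _ _.
have -> : \sum_k (\sum_i dphi i (X s) * X' s i k) * z s t k =
    \sum_i dphi i (X s) * (\sum_k X' s i k * z s t k).
  under eq_bigr do rewrite mulr_suml.
  rewrite exchange_big; apply: eq_bigr => i _; rewrite mulr_sumr.
  by apply: eq_bigr => k _; rewrite mulrA.
under [X in _ + X]eq_bigr do rewrite mulrBr.
by rewrite sumrB; ring.
Qed.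

End ScalarControlledPaths.

(** * Local expansion of time integrals *)

Section TimeIntegral.
Local Open Scope classical_set_scope.
Local Open Scope ring_scope.
Variables (R : realType) (a b al : R).
Hypothesis al0 : 0 < al.
Variable g : R -> R.
Hypothesis hg : hoelder a b al g.
Local Notation mu := (@lebesgue_measure R).

Lemma hoelder_continuous : {within `[a, b], continuous g}.
Proof.
have [C hC] := hg.
have hC' x y : x \in `[a, b] -> y \in `[a, b] ->
    `|g x - g y| <= `|C| * `|x - y| `^ al.
  rewrite !in_itv /= => /andP[ax xb] /andP[ay yb].
  have D s t : a <= s -> s <= t -> t <= b -> `|g t - g s| <= `|C| * `|t - s| `^ al.
    move=> as_ st tb; apply: le_trans (hC _ _ as_ st tb) _.
    by rewrite (@ger0_norm _ (t - s)) ?subr_ge0 // ler_wpM2r ?powR_ge0 ?ler_norm.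
  have [xy|/ltW yx] := leP x y; last exact: D.
  by rewrite distrC [X in X `^ _]distrC; exact: D.
apply/subspace_continuousP => x xab; apply/cvgrPdist_le => /= e e0.
have C0 : 0 < `|C| + 1 by rewrite ltr_wpDl.
pose d := (e / (`|C| + 1)) `^ al^-1.
have d0 : 0 < d by rewrite powR_gt0 // divr_gt0.
rewrite !near_withinE; near=> y => yab.
apply: le_trans (hC' _ _ xab yab) _.
have : `|x - y| `^ al <= d `^ al.
  apply: ge0_ler_powR; [exact: ltW|by rewrite nnegrE|by rewrite nnegrE ltW|].
  by near: y; apply: filterS (nbhsx_ballx x d d0) => y; rewrite -ball_normE /=; exact: ltW.
rewrite /d -powRrM mulVf ?gt_eqF // powRr1; last by rewrite divr_ge0 ?ltW.
move=> h; apply: le_trans (ler_wpM2l (normr_ge0 C) h) _.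
by rewrite mulrCA ger_pMr // ler_pdivrMr // mul1r lerDl.
Unshelve. all: by end_near. Qed.

Lemma hoelder_integrable s t : a <= s -> t <= b ->
  mu.-integrable `[s, t] (EFin \o g).
Proof.
move=> as_ tb.
apply: integrableS (continuous_compact_integrable (@segment_compact _ a b)
  hoelder_continuous); [exact: measurable_itv|exact: measurable_itv|].
move=> r /=; rewrite !in_itv /= => /andP[sr rt].
by rewrite (le_trans as_ sr) (le_trans rt tb).
Qed.

Lemma Rintegral_left s t : a <= s -> s <= t -> t <= b ->
  \int[mu]_(r in `[a, t]) g r - \int[mu]_(r in `[a, s]) g r =
  \int[mu]_(r in `[s, t]) g r.
Proof.
move=> as_ st tb; rewrite Rintegral_itvB ?bnd_simp //; last first.
  exact: hoelder_integrable.
rewrite Rintegral_itv_obnd_cbnd //.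
apply: integrableS (hoelder_integrable as_ tb) => //.
by apply: subset_itvr; rewrite bnd_simp.
Qed.

Lemma Rintegral_right s t : a <= s -> s <= t -> t <= b ->
  \int[mu]_(r in `[s, b]) g r - \int[mu]_(r in `[t, b]) g r =
  \int[mu]_(r in `[s, t]) g r.
Proof.
move=> as_ st tb; apply/eqP; rewrite subr_eq addrC -subr_eq; apply/eqP.
rewrite Rintegral_itvB ?bnd_simp //; last exact: hoelder_integrable.
rewrite Rintegral_itv_obnd_cbnd //.
apply: integrableS (hoelder_integrable (le_trans as_ st) (lexx b)) => //.
by apply: subset_itvr; rewrite bnd_simp.
Qed.

(** Freezing the integrand at the left end point costs at most its oscillation,
    of order [al], times the length of the interval. *)
Lemma Rintegral_germ : bigO2 a b (1 + al)
  (fun s t => \int[mu]_(r in `[s, t]) g r - g s * (t - s)).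
Proof.
have [C hC] := hg; exists `|C| => s t as_ st tb.
have ist := hoelder_integrable as_ tb.
have lst : fine (mu `[s, t]) = t - s.
  rewrite lebesgue_measure_itv /= lte_fin.
  have [->|nst] := eqVneq s t; first by rewrite ltxx /= subrr.
  by rewrite lt_neqAle nst st.
have icst c : mu.-integrable `[s, t] (EFin \o (fun=> c)).
  apply: continuous_compact_integrable; first exact: segment_compact.
  by apply: continuous_subspaceT => x; exact: cvg_cst.
have -> : g s * (t - s) = \int[mu]_(r in `[s, t]) g s by rewrite Rintegral_cst ?lst.
rewrite -RintegralB //.
have iB : mu.-integrable `[s, t] (EFin \o (fun r => g r - g s)).
  exact: (integrableB _ ist (icst (g s))).
apply: le_trans (le_normr_Rintegral _ iB) _; first exact: measurable_itv.
rewrite (addrC 1) powRD; last by rewrite gt_eqF // addr_gt0.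
rewrite powRr1 ?subr_ge0 // mulrA -{2}lst -Rintegral_cst //.
apply: le_Rintegral => //; first by have := integrable_abse iB.
move=> r; rewrite /= in_itv /= => /andP[sr rt].
apply: le_trans (hC _ _ as_ sr (le_trans rt tb)) _.
apply: le_trans (ler_wpM2r (powR_ge0 _ _) (ler_norm C)) _.
by rewrite ler_wpM2l // ge0_ler_powR ?nnegrE ?subr_ge0 ?(ltW al0) // lerD2r.
Qed.

End TimeIntegral.

(** * Local expansion of rough integrals *)

Section Germs.
Variables (R : realType) (K : nat) (a b al : R).
Variables (Z : R -> 'cV[R]_K) (ZZ : R -> R -> 'M[R]_K).
Hypotheses (al0 : 0 < al) (al3 : 1 < 3 * al).
Hypothesis hZ : geometric_rough_path al a b Z ZZ.
Local Notation z s t k := (Z t k 0 - Z s k 0).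

(** An entry of [compensated], the local approximation of the rough integral;
    [Y' u k j] is the derivative of [Y u j] in the direction [k]. *)
Definition germ (Y : R -> 'I_K -> R) (Y' : R -> 'I_K -> 'I_K -> R) (u v : R) : R :=
  \sum_j Y u j * z u v j + \sum_k \sum_j Y' u k j * ZZ u v k j.

Lemma compensated_coord (m : nat) (Y : R -> 'M[R]_(m, K))
    (Y' : R -> 'I_K -> 'M[R]_(m, K)) l u v :
  compensated Z ZZ Y Y' u v l 0 =
  germ (fun r => Y r l) (fun r k => Y' r k l) u v.
Proof.
rewrite /compensated /germ !mxE summxE; congr (_ + _).
  by apply: eq_bigr => j _; rewrite !mxE.
by apply: eq_bigr => k _; rewrite mxE; apply: eq_bigr => j _; rewrite !mxE.
Qed.

Lemma three_point_sum (I : finType) (D : I -> R -> R -> R -> R) g :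
  (forall i, exists C, forall s u t, a <= s -> s <= u -> u <= t -> t <= b ->
     `|D i s u t| <= C * (t - s) `^ g) ->
  exists C, forall s u t, a <= s -> s <= u -> u <= t -> t <= b ->
     `|\sum_i D i s u t| <= C * (t - s) `^ g.
Proof.
move=> /choice[C hC]; exists (\sum_i C i) => s u t as_ su ut tb.
apply: le_trans (ler_norm_sum _ _ _) _; rewrite mulr_suml.
by apply: ler_sum => i _; exact: hC.
Qed.

(** [u - s] and [t - u] are both at most [t - s]. *)
Lemma three_point_prod (A B : R -> R -> R) g h : 0 < g -> 0 < h ->
  bigO2 a b g A -> bigO2 a b h B ->
  exists C, forall s u t, a <= s -> s <= u -> u <= t -> t <= b ->
     `|A s u * B u t| <= C * (t - s) `^ (g + h).
Proof.
move=> g0 h0 [C hC] [D hD]; exists (`|C| * `|D|) => s u t as_ su ut tb.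
rewrite normrM powRD; last by rewrite gt_eqF // addr_gt0.
rewrite mulrACA ler_pM //.
  apply: le_trans (hC _ _ as_ su (le_trans ut tb)) _.
  apply: le_trans (ler_wpM2r (powR_ge0 _ _) (ler_norm C)) _.
  rewrite ler_wpM2l // ge0_ler_powR ?nnegrE ?subr_ge0 ?(ltW g0) //.
    exact: le_trans ut.
  by rewrite lerD2r.
apply: le_trans (hD _ _ (le_trans as_ su) ut tb) _.
apply: le_trans (ler_wpM2r (powR_ge0 _ _) (ler_norm D)) _.
rewrite ler_wpM2l // ge0_ler_powR ?nnegrE ?subr_ge0 ?(ltW h0) //.
  exact: le_trans ut.
by rewrite lerD2l lerN2.
Qed.

Lemma chen_coord s u t k j : a <= s -> s <= u -> u <= t -> t <= b ->
  ZZ s t k j = ZZ s u k j + ZZ u t k j + z s u k * z u t j.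
Proof.
move=> as_ su ut tb; rewrite (grp_chen hZ as_ su ut tb) !mxE; congr (_ + _).
by rewrite big_ord1 !mxE.
Qed.

Lemma geom_coord s t k j : a <= s -> s <= t -> t <= b ->
  ZZ s t k j + ZZ s t j k = z s t k * z s t j.
Proof.
move=> as_ st tb; have := grp_geom hZ as_ st tb.
by move=> /(congr1 (fun M : 'M[R]_K => M k j)); rewrite !mxE big_ord1 !mxE.
Qed.

(** By Chen's relation the failure of additivity is exactly the remainder of [Y]
    against an increment of [Z], of order [2 * al + al], plus an increment of [Y']
    against [ZZ], of order [al + 2 * al]. *)
Lemma germ_defect (Y : R -> 'I_K -> R) (Y' : R -> 'I_K -> 'I_K -> R) :
  (forall j, scontrolled a b al Z (fun r => Y r j) (fun r k => Y' r k j)) ->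
  exists C, forall s u t, a <= s -> s <= u -> u <= t -> t <= b ->
   `|germ Y Y' s t - germ Y Y' s u - germ Y Y' u t| <= C * (t - s) `^ (3 * al).
Proof.
move=> hY.
have hz j : bigO2 a b al (fun s t => z s t j).
  apply: eq_bigO2 (holder2_bigO2 (grp_holder1 hZ) j 0) => s t _ _ _.
  by rewrite !mxE.
have hZZ k j : bigO2 a b (2 * al) (fun s t => ZZ s t k j).
  exact: holder2_bigO2 (grp_holder2 hZ) k j.
have al20 : 0 < 2 * al by rewrite mulr_gt0.
have d1 j : exists C, forall s u t, a <= s -> s <= u -> u <= t -> t <= b ->
    `|(Y u j - Y s j - \sum_k Y' s k j * z s u k) * z u t j|
      <= C * (t - s) `^ (3 * al).
  have [_ _ hr] := hY j.
  have := three_point_prod al20 al0 hr (hz j).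
  by rewrite (_ : 2 * al + al = 3 * al) //; ring.
have d2 k : exists C, forall s u t, a <= s -> s <= u -> u <= t -> t <= b ->
    `|\sum_j (Y' u k j - Y' s k j) * ZZ u t k j| <= C * (t - s) `^ (3 * al).
  apply: (@three_point_sum _ (fun j s u t => (Y' u k j - Y' s k j) * ZZ u t k j)).
  move=> j; have [_ hd _] := hY j.
  have := three_point_prod al0 al20 (hd k) (hZZ k j).
  by rewrite (_ : al + 2 * al = 3 * al) //; ring.
have [C1 h1] := three_point_sum d1; have [C2 h2] := three_point_sum d2.
exists (C1 + C2) => s u t as_ su ut tb.
have -> : germ Y Y' s t - germ Y Y' s u - germ Y Y' u t =
  - (\sum_j (Y u j - Y s j - \sum_k Y' s k j * z s u k) * z u t j +
     \sum_k \sum_j (Y' u k j - Y' s k j) * ZZ u t k j).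
  rewrite /germ.
  have -> : \sum_k \sum_j Y' s k j * ZZ s t k j =
     \sum_k \sum_j Y' s k j * ZZ s u k j + \sum_k \sum_j Y' s k j * ZZ u t k j +
     \sum_j (\sum_k Y' s k j * z s u k) * z u t j.
    have -> : \sum_j (\sum_k Y' s k j * z s u k) * z u t j =
        \sum_k \sum_j Y' s k j * z s u k * z u t j.
      by rewrite exchange_big; apply: eq_bigr => j _; rewrite mulr_suml.
    rewrite -!big_split /=; apply: eq_bigr => k _.
    rewrite -!big_split /=; apply: eq_bigr => j _.
    by rewrite (chen_coord k j as_ su ut tb); ring.
  have -> : \sum_j Y s j * z s t j = \sum_j Y s j * z s u j + \sum_j Y s j * z u t j.
    by rewrite -big_split; apply: eq_bigr => j _ /=; ring.
  have -> : \sum_j (Y u j - Y s j - \sum_k Y' s k j * z s u k) * z u t j =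
    \sum_j Y u j * z u t j - \sum_j Y s j * z u t j -
    \sum_j (\sum_k Y' s k j * z s u k) * z u t j.
    by rewrite -!sumrB; apply: eq_bigr => j _ /=; ring.
  have -> : \sum_k \sum_j (Y' u k j - Y' s k j) * ZZ u t k j =
    \sum_k \sum_j Y' u k j * ZZ u t k j - \sum_k \sum_j Y' s k j * ZZ u t k j.
    rewrite -sumrB; apply: eq_bigr => k _; rewrite -sumrB.
    by apply: eq_bigr => j _; ring.
  ring.
rewrite normrN mulrDl; apply: le_trans (ler_normD _ _) _.
by apply: lerD; [exact: h1|exact: h2].
Qed.

Lemma compensated_limit (m : nat) (Y : R -> 'M[R]_(m, K)) Y' l u v I :
  is_rough_integral Z ZZ Y Y' u v I ->
  sum_limit (germ (fun r => Y r l) (fun r k => Y' r k l)) u v (I l 0).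
Proof.
move=> /(is_rough_integral_coord l); congr (sum_limit _ _ _ _).
by apply/funext => s; apply/funext => t; rewrite compensated_coord.
Qed.

Section Expansion.
Variables (m : nat) (Y : R -> 'M[R]_(m, K)) (Y' : R -> 'I_K -> 'M[R]_(m, K)).
Variables (g : R -> 'cV[R]_m) (l : 'I_m).
Hypothesis al2 : al <= 2^-1.
Hypothesis hY : forall j, scontrolled a b al Z (fun r => Y r l j) (fun r k => Y' r k l j).
Hypothesis hg : hoelder a b al (fun r => g r l 0).
Local Notation G := (germ (fun r => Y r l) (fun r k => Y' r k l)).

(** The rough part is controlled by sewing to order [3 * al], the time part by
    [Rintegral_germ] to order [1 + al], and [3 * al <= 1 + al]. *)
Lemma local_expansion_forward (x : R -> 'cV[R]_m) :
  (forall t, a <= t -> t <= b -> exists2 J, is_rough_integral Z ZZ Y Y' a t J &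
     x t - x a = time_integral g a t + J) ->
  bigO2 a b (3 * al) (fun s t => x t l 0 - x s l 0 -
    (g s l 0 * (t - s) + G s t)).
Proof.
move=> hx; have [C hC] := germ_defect hY.
have al1 : 3 * al <= 1 + al by move: al2 => al2'; lra.
have [D hD] := bigO2_weaken (lt_trans ltr01 al3) al1 (Rintegral_germ al0 hg).
exists (D + sewing_cst (3 * al) C) => s t as_ st tb.
have [I hI eI] := hx _ as_ (le_trans st tb).
have [J hJ eJ] := hx _ (le_trans as_ st) tb.
have := sewing_bound_forward al3 hC as_ st tb (compensated_limit l hI)
  (compensated_limit l hJ).
have := hD _ _ as_ st tb; rewrite -(Rintegral_left al0 hg as_ st tb) => h1 h2.
have -> : x t l 0 - x s l 0 = (x t - x a) l 0 - (x s - x a) l 0.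
  by rewrite !mxE; ring.
rewrite eI eJ ![(_ + _ : matrix _ _ _) l 0]mxE ![time_integral _ _ _ _ _]mxE mulrDl.
apply: le_trans _ (lerD h1 h2).
apply: le_trans _ (ler_normD _ _).
by rewrite le_eqVlt; apply/orP; left; apply/eqP; congr (`|_|); ring.
Qed.

Lemma local_expansion_backward (x : R -> 'cV[R]_m) :
  (forall t, a <= t -> t <= b -> exists2 J, is_rough_integral Z ZZ Y Y' t b J &
     x b - x t = - (time_integral g t b + J)) ->
  bigO2 a b (3 * al) (fun s t => x t l 0 - x s l 0 +
    (g s l 0 * (t - s) + G s t)).
Proof.
move=> hx; have [C hC] := germ_defect hY.
have al1 : 3 * al <= 1 + al by move: al2 => al2'; lra.
have [D hD] := bigO2_weaken (lt_trans ltr01 al3) al1 (Rintegral_germ al0 hg).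
exists (D + sewing_cst (3 * al) C) => s t as_ st tb.
have [I hI eI] := hx _ as_ (le_trans st tb).
have [J hJ eJ] := hx _ (le_trans as_ st) tb.
have := sewing_bound_backward al3 hC as_ st tb (compensated_limit l hI)
  (compensated_limit l hJ).
have := hD _ _ as_ st tb; rewrite -(Rintegral_right al0 hg as_ st tb) => h1 h2.
have -> : x t l 0 - x s l 0 = (x b - x s) l 0 - (x b - x t) l 0.
  by rewrite !mxE; ring.
rewrite eI eJ ![(- _ : matrix _ _ _) l 0]mxE ![(_ + _ : matrix _ _ _) l 0]mxE.
rewrite ![time_integral _ _ _ _ _]mxE mulrDl.
rewrite -normrN in h1; rewrite -normrN in h2.
apply: le_trans _ (lerD h1 h2).
apply: le_trans _ (ler_normD _ _).
by rewrite le_eqVlt; apply/orP; left; apply/eqP; congr (`|_|); ring.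
Qed.

End Expansion.
End Germs.

(** * Algebra of the pairing, and partial derivatives of paired maps *)

Section PairingAlgebra.
Variables (R : realType) (n K : nat).
Variables (p v : 'I_n -> R) (D : 'I_n -> 'I_n -> 'I_K -> R).
Variables (S : 'I_n -> 'I_n -> 'I_n -> 'I_K -> R) (s : 'I_n -> 'I_K -> R).
Variables (z : 'I_K -> R) (ZZ : 'I_K -> 'I_K -> R).
Hypothesis geom : forall k j, ZZ k j + ZZ j k = z k * z j.

Variables (A B : 'I_n -> 'I_K -> R) (A' B' : 'I_K -> 'I_n -> 'I_K -> R).
Hypothesis AE : forall l j, A l j = \sum_i D i l j * v i.
Hypothesis BE : forall i j, B i j = \sum_l p l * D i l j.
Hypothesis A'E : forall k l j, A' k l j =
  \sum_m s m k * (\sum_i S m i l j * v i) + \sum_m A m k * D m l j.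
Hypothesis B'E : forall k l j, B' k l j =
  \sum_m s m k * (\sum_i p i * S m l i j) + \sum_m - B m k * D l m j.

(** Transposition: [A] is the Jacobian applied to [v] and [B] its adjoint applied
    to [p]. *)
Lemma pairing_duality j : \sum_l p l * A l j = \sum_l v l * B l j.
Proof.
under eq_bigr do rewrite AE mulr_sumr; rewrite exchange_big /=.
by apply: eq_bigr => i _; rewrite BE mulr_sumr; apply: eq_bigr => l _; ring.
Qed.

(** The second derivatives [S] enter both sides with the same coefficients and
    cancel; what survives comes from the derivatives of [v] and [p] themselves. *)
Lemma pairing_second_order k j :
  \sum_l (p l * A' k l j - v l * B' k l j) =
  \sum_m (A m k * B m j + B m k * A m j).
Proof.
have hA : \sum_l p l * A' k l j =
    \sum_m \sum_l \sum_i s m k * p l * S m i l j * v i + \sum_m A m k * B m j.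
  transitivity (\sum_l \sum_m (\sum_i s m k * p l * S m i l j * v i +
      A m k * (p l * D m l j))).
    apply: eq_bigr => l _; rewrite A'E mulrDr !mulr_sumr -big_split /=.
    apply: eq_bigr => m _; congr (_ + _); last by ring.
    by rewrite !mulr_sumr; apply: eq_bigr => i _; ring.
  rewrite exchange_big -big_split /=; apply: eq_bigr => m _.
  by rewrite big_split /= -mulr_sumr BE.
have hB : \sum_l v l * B' k l j =
    \sum_m \sum_l \sum_i s m k * p l * S m i l j * v i - \sum_m B m k * A m j.
  transitivity (\sum_l \sum_m (\sum_i s m k * p i * S m l i j * v l -
      B m k * (D l m j * v l))).
    apply: eq_bigr => l _; rewrite B'E mulrDr !mulr_sumr -big_split /=.
    apply: eq_bigr => m _; congr (_ + _); last by ring.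
    by rewrite !mulr_sumr; apply: eq_bigr => i _; ring.
  rewrite exchange_big -sumrB /=; apply: eq_bigr => m _.
  by rewrite sumrB -mulr_sumr AE; congr (_ - _); rewrite exchange_big.
rewrite sumrB hA hB big_split /=; ring.
Qed.

(** The coefficient of [ZZ] is symmetric in [k] and [j], so only the symmetric
    part of [ZZ] contributes, and for a geometric rough path that part is half of the
    product of increments. *)
Lemma pairing_geometric :
  \sum_k \sum_j (\sum_m (A m k * B m j + B m k * A m j)) * ZZ k j =
  \sum_m (\sum_j B m j * z j) * (\sum_k A m k * z k).
Proof.
transitivity (\sum_m \sum_k \sum_j (A m k * B m j + B m k * A m j) * ZZ k j).
  rewrite [RHS]exchange_big /=; apply: eq_bigr => k _.
  rewrite [RHS]exchange_big /=; apply: eq_bigr => j _.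
  by rewrite mulr_suml.
apply: eq_bigr => m _.
transitivity (\sum_k \sum_j A m k * B m j * ZZ k j +
    \sum_k \sum_j B m k * A m j * ZZ k j).
  rewrite -big_split /=; apply: eq_bigr => k _; rewrite -big_split /=.
  by apply: eq_bigr => j _; ring.
rewrite [X in _ + X]exchange_big -big_split /= mulr_sumr.
apply: eq_bigr => k _; rewrite -big_split mulr_suml /=.
apply: eq_bigr => j _.
transitivity (A m k * B m j * (ZZ k j + ZZ j k)); first by ring.
by rewrite geom; ring.
Qed.

(** Every term of the expansion of the pairing that is of order below [3 * al]
    cancels: the drift and the first-level terms by duality, the second-level terms
    against the product of the first-order increments of [p] and [v]. *)
Lemma pairing_germ_cancels (F G : 'I_n -> R) (h : R) :
  \sum_l p l * F l = \sum_l v l * G l ->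
  \sum_l (p l * (F l * h + (\sum_j A l j * z j + \sum_k \sum_j A' k l j * ZZ k j))
    - v l * (G l * h + (\sum_j B l j * z j + \sum_k \sum_j B' k l j * ZZ k j))
    - (\sum_j B l j * z j) * (\sum_k A l k * z k)) = 0.
Proof.
move=> FG; rewrite sumrB -pairing_geometric.
have -> : \sum_k \sum_j (\sum_m (A m k * B m j + B m k * A m j)) * ZZ k j =
   \sum_l (p l * (\sum_k \sum_j A' k l j * ZZ k j) -
           v l * (\sum_k \sum_j B' k l j * ZZ k j)).
  transitivity (\sum_k \sum_j \sum_l (p l * A' k l j - v l * B' k l j) * ZZ k j).
    apply: eq_bigr => k _; apply: eq_bigr => j _.
    by rewrite -pairing_second_order mulr_suml.
  rewrite [RHS](_ : _ = \sum_l \sum_k \sum_j (p l * A' k l j - v l * B' k l j) * ZZ k j).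
    rewrite [RHS]exchange_big; apply: eq_bigr => k _.
    by rewrite [RHS]exchange_big.
  apply: eq_bigr => l _; rewrite !mulr_sumr -sumrB; apply: eq_bigr => k _.
  by rewrite !mulr_sumr -sumrB; apply: eq_bigr => j _; ring.
have first : \sum_l p l * (\sum_j A l j * z j) = \sum_l v l * (\sum_j B l j * z j).
  transitivity (\sum_j (\sum_l p l * A l j) * z j).
    under [RHS]eq_bigr do rewrite mulr_suml.
    rewrite [RHS]exchange_big; apply: eq_bigr => l _; rewrite mulr_sumr.
    by apply: eq_bigr => j _; rewrite mulrA.
  under eq_bigr do rewrite pairing_duality mulr_suml.
  rewrite exchange_big; apply: eq_bigr => l _; rewrite mulr_sumr.
  by apply: eq_bigr => j _; rewrite mulrA.
rewrite -sumrB.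
transitivity ((\sum_l p l * F l - \sum_l v l * G l) * h +
  (\sum_l p l * (\sum_j A l j * z j) - \sum_l v l * (\sum_j B l j * z j))).
  rewrite -!sumrB mulr_suml -big_split /=; apply: eq_bigr => l _; ring.
by rewrite FG first !subrr mul0r addr0.
Qed.

End PairingAlgebra.

Section PartialsOnPairs.
Local Open Scope classical_set_scope.
Local Open Scope ring_scope.
Variables (R : realType).

Lemma is_derive_partial (n m k : nat) (phi : 'cV[R]_n -> 'M[R]_(m, k)) i x l j :
  derivable phi x (delta_mx i 0) ->
  is_derive x (delta_mx i 0 : 'cV[R]_n) (fun y => phi y l j) (partial i phi x l j).
Proof.
move=> d; split; first by move/derivable_mxP : d; apply.
by rewrite /partial derive_mx // mxE.
Qed.

(** Partial derivatives of a matrix-valued map are taken in the normed space of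
    matrices; this reduces them to real-valued entries. *)
Lemma partial_coord (n m k : nat) (phi : 'cV[R]_n -> 'M[R]_(m, k)) i x
    (dphi : 'M[R]_(m, k)) :
  (forall l j, is_derive x (delta_mx i 0 : 'cV[R]_n) (fun y => phi y l j) (dphi l j)) ->
  partial i phi x = dphi.
Proof.
move=> h; rewrite /partial derive_mx; last first.
  by apply/derivable_mxP => l j; have [] := h l j.
by apply/matrixP => l j; rewrite mxE; have [] := h l j.
Qed.

Lemma smooth_partial (n m k : nat) (phi : 'cV[R]_n -> 'M[R]_(m, k)) i :
  smooth phi -> smooth (partial i phi).
Proof. by move=> h s; have := h (rcons s i); rewrite foldr_rcons. Qed.

Lemma smooth_has_partials (n m k : nat) (phi : 'cV[R]_n -> 'M[R]_(m, k)) l j :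
  smooth phi ->
  has_partials (fun x => phi x l j) (fun i x => partial i phi x l j).
Proof. by move=> h i x; apply: is_derive_partial; have [_] := h [::]; apply. Qed.

Lemma smooth_continuous_coord (n m k : nat) (phi : 'cV[R]_n -> 'M[R]_(m, k)) l j :
  smooth phi -> continuous (fun x => phi x l j).
Proof.
move=> h x; have [/(_ x) c _] := h [::].
exact: (continuous_comp c (@coord_continuous _ _ _ l j _)).
Qed.

(** The coordinate functions are the entries of the identity. *)
Lemma is_derive_lincomb (n : nat) (c : 'I_n -> R) i x :
  is_derive x (delta_mx i 0 : 'cV[R]_n) (fun y : 'cV[R]_n => \sum_l c l * y l 0) (c i).
Proof.
have d l : is_derive x (delta_mx i 0 : 'cV[R]_n) (fun y : 'cV[R]_n => c l * y l 0)
    (c l * (l == i)%:R).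
  have := @is_derive_partial _ _ _ (id : 'cV[R]_n -> 'cV[R]_n) i x l 0
    (@derivable_id _ _ _ _).
  rewrite /partial derive_id mxE eqxx andbT => dl.
  by have := @is_deriveZ _ _ _ _ (c l) _ _ _ dl.
rewrite (_ : (fun y => _) = \sum_l (fun y : 'cV[R]_n => c l * y l 0)); last first.
  by apply/funext => y; rewrite fct_sumE.
apply: (is_derive_eq (is_derive_sum d)).
rewrite (bigD1 i) //= eqxx mulr1 big1 ?addr0 // => l /negbTE->.
by rewrite mulr0.
Qed.

Lemma partial_on_pair_u (n m k : nat) (phi : 'cV[R]_n -> 'cV[R]_n -> 'M[R]_(m, k))
    (i : 'I_n) x y :
  partial (lshift n i) (on_pair phi) (col_mx x y) = partial i (phi^~ y) x.
Proof.
have E : (fun h : R => h^-1 *: ((on_pair phi \o shift (col_mx x y))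
      (h *: delta_mx (lshift n i) 0) - on_pair phi (col_mx x y))) =
    (fun h : R => h^-1 *: ((phi^~ y \o shift x) (h *: delta_mx i 0) - phi x y)); last first.
  by rewrite /partial /derive E.
apply/funext => h /=.
rewrite /on_pair col_mxKu col_mxKd; congr (_ *: (phi _ _ - _)).
  by apply/colP => a; rewrite [LHS]mxE [LHS]mxE [RHS]mxE col_mxEu !mxE eq_lshift.
by apply/colP => a; rewrite [LHS]mxE [LHS]mxE col_mxEd !mxE eq_rlshift mulr0 add0r.
Qed.

Lemma partial_on_pair_d (n m k : nat) (phi : 'cV[R]_n -> 'cV[R]_n -> 'M[R]_(m, k))
    (i : 'I_n) x y :
  partial (rshift n i) (on_pair phi) (col_mx x y) = partial i (phi x) y.
Proof.
have E : (fun h : R => h^-1 *: ((on_pair phi \o shift (col_mx x y))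
      (h *: delta_mx (rshift n i) 0) - on_pair phi (col_mx x y))) =
    (fun h : R => h^-1 *: ((phi x \o shift y) (h *: delta_mx i 0) - phi x y)); last first.
  by rewrite /partial /derive E.
apply/funext => h /=.
rewrite /on_pair col_mxKu col_mxKd; congr (_ *: (phi _ _ - _)).
  by apply/colP => a; rewrite [LHS]mxE [LHS]mxE col_mxEu !mxE eq_lrshift mulr0 add0r.
by apply/colP => a; rewrite [LHS]mxE [LHS]mxE [RHS]mxE col_mxEd !mxE eq_rshift.
Qed.

Lemma is_derive_weighted_sum (n : nat) (g : 'I_n -> 'cV[R]_n -> R)
    (c : 'I_n -> R) (dg : 'I_n -> R) (x e : 'cV[R]_n) :
  (forall i, is_derive x e (g i) (dg i)) ->
  is_derive x e (fun y => \sum_i c i * g i y) (\sum_i c i * dg i).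
Proof.
move=> h.
rewrite (_ : (fun y => _) = \sum_i (fun y : 'cV[R]_n => c i * g i y)); last first.
  by apply/funext => y; rewrite fct_sumE.
apply: is_derive_sum => i; exact: (@is_deriveZ _ _ _ _ (c i) _ _ _ (h i)).
Qed.

End PartialsOnPairs.

(** * The linearized coefficients along a solution *)

Section LinearizedCoefficients.
Variables (R : realType) (n K : nat) (phi : 'cV[R]_n -> 'M[R]_(n, K)).
Hypothesis hphi : smooth phi.
Implicit Types q v p : 'cV[R]_n.

(** The order of differentiation, [partial i] first, is the same as in
    [partial_dstar_u], so the two families of second derivatives can be compared
    term by term. *)
Lemma partial_dapp_u m q v l j :
  partial (lshift n m) (on_pair (dapp phi)) (col_mx q v) l j =
  \sum_i partial m (partial i phi) q l j * v i 0.
Proof.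
rewrite partial_on_pair_u.
have -> : partial m ((dapp phi)^~ v) q =
    \matrix_(l, j) \sum_i v i 0 * partial m (partial i phi) q l j; last first.
  by rewrite mxE; apply: eq_bigr => i _; rewrite mulrC.
apply: partial_coord.
move=> {}l {}j; rewrite mxE.
rewrite (_ : (fun y => dapp phi y v l j) = (fun y => \sum_i v i 0 * partial i phi y l j)).
  apply: is_derive_weighted_sum => i.
  exact: smooth_has_partials (smooth_partial i hphi) m q.
by apply/funext => y; rewrite mxE; apply: eq_bigr => i _; rewrite mulrC.
Qed.

Lemma partial_dapp_d m q v l j :
  partial (rshift n m) (on_pair (dapp phi)) (col_mx q v) l j = partial m phi q l j.
Proof.
rewrite partial_on_pair_d.
suff -> : partial m (dapp phi q) v = partial m phi q by [].
apply: partial_coord.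
move=> {}l {}j.
rewrite (_ : (fun y => dapp phi q y l j) = (fun y => \sum_i partial i phi q l j * y i 0)).
  exact: is_derive_lincomb.
by apply/funext => y; rewrite mxE.
Qed.

Lemma partial_dstar_u m q p i j :
  partial (lshift n m) (on_pair (dstar phi)) (col_mx q p) i j =
  \sum_l p l 0 * partial m (partial i phi) q l j.
Proof.
rewrite partial_on_pair_u.
have -> : partial m ((dstar phi)^~ p) q =
    \matrix_(i, j) \sum_l p l 0 * partial m (partial i phi) q l j; last first.
  by rewrite mxE.
apply: partial_coord.
move=> {}i {}j; rewrite mxE.
rewrite (_ : (fun y => dstar phi y p i j) = (fun y => \sum_l p l 0 * partial i phi y l j)).
  apply: is_derive_weighted_sum => l.
  exact: smooth_has_partials (smooth_partial i hphi) m q.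
by apply/funext => y; rewrite mxE.
Qed.

Lemma partial_dstar_d m q p i j :
  partial (rshift n m) (on_pair (dstar phi)) (col_mx q p) i j = partial i phi q m j.
Proof.
rewrite partial_on_pair_d.
have -> : partial m (dstar phi q) p = \matrix_(i, j) partial i phi q m j; last first.
  by rewrite mxE.
apply: partial_coord.
move=> {}i {}j; rewrite mxE.
rewrite (_ : (fun y => dstar phi q y i j) = (fun y => \sum_l partial i phi q l j * y l 0)).
  exact: is_derive_lincomb.
by apply/funext => y; rewrite mxE; apply: eq_bigr => l _; rewrite mulrC.
Qed.

Variables (x y : R -> 'cV[R]_n) (x' y' : R -> 'M[R]_(n, K)).
Local Notation X := (fun r => col_mx (x r) (y r)).
Local Notation X' := (fun r => col_mx (x' r) (y' r)).

Lemma gub_comp_dapp r k l j :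
  gub_comp (on_pair (dapp phi)) X X' r k l j =
  \sum_m x' r m k * (\sum_i partial m (partial i phi) (x r) l j * y r i 0) +
  \sum_m y' r m k * partial m phi (x r) l j.
Proof.
rewrite /gub_comp summxE big_split_ord /=; congr (_ + _); apply: eq_bigr => m _.
  by rewrite mxE partial_dapp_u col_mxEu.
by rewrite mxE partial_dapp_d col_mxEd.
Qed.

Lemma gub_comp_dstar r k i j :
  gub_comp (on_pair (dstar phi)) X X' r k i j =
  \sum_m x' r m k * (\sum_l y r l 0 * partial m (partial i phi) (x r) l j) +
  \sum_m y' r m k * partial i phi (x r) m j.
Proof.
rewrite /gub_comp summxE big_split_ord /=; congr (_ + _); apply: eq_bigr => m _.
  by rewrite mxE partial_dstar_u col_mxEu.
by rewrite mxE partial_dstar_d col_mxEd.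
Qed.

Variables (a b al : R) (Z : R -> 'cV[R]_K).
Hypothesis al0 : 0 < al.
Hypothesis hx : forall i, scontrolled a b al Z (fun r => x r i 0) (fun r k => x' r i k).
Hypothesis hy : forall i, scontrolled a b al Z (fun r => y r i 0) (fun r k => y' r i k).

Lemma scontrolled_partial i l j : scontrolled a b al Z
  (fun r => partial i phi (x r) l j)
  (fun r k => \sum_m partial m (partial i phi) (x r) l j * x' r m k).
Proof.
have hi := smooth_partial i hphi.
apply: (scontrolled_comp al0 hx (smooth_has_partials l j hi)).
- by move=> m; apply: smooth_continuous_coord; exact: smooth_partial.
- by move=> m; exact: smooth_has_partials (smooth_partial m hi).
- by move=> m m'; apply: smooth_continuous_coord; do 2 apply: smooth_partial.
Qed.

(** The derivative produced by the Leibniz and chain rules for the entries is the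
    one prescribed by the rough integral, namely [gub_comp] of the coefficient seen as
    a function of the stacked path. *)
Lemma scontrolled_dapp l j : scontrolled a b al Z
  (fun r => on_pair (dapp phi) (X r) l j)
  (fun r k => gub_comp (on_pair (dapp phi)) X X' r k l j).
Proof.
rewrite (_ : (fun r => _) =
  (fun r => \sum_i partial i phi (x r) l j * y r i 0)); last first.
  by apply/funext => r; rewrite /on_pair col_mxKu col_mxKd mxE.
apply: eq_scontrolled (scontrolled_sum (index_enum 'I_n)
  (fun i => scontrolledM al0 (scontrolled_partial i l j) (hy i))) => r k.
rewrite gub_comp_dapp big_split /=; congr (_ + _); last first.
  by apply: eq_bigr => i _; rewrite mulrC.
under eq_bigr do rewrite mulr_suml.
rewrite exchange_big /=; apply: eq_bigr => m _; rewrite mulr_sumr.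
by apply: eq_bigr => i _; ring.
Qed.

Lemma scontrolled_dstar i j : scontrolled a b al Z
  (fun r => on_pair (dstar phi) (X r) i j)
  (fun r k => gub_comp (on_pair (dstar phi)) X X' r k i j).
Proof.
rewrite (_ : (fun r => _) =
  (fun r => \sum_l y r l 0 * partial i phi (x r) l j)); last first.
  by apply/funext => r; rewrite /on_pair col_mxKu col_mxKd mxE.
apply: eq_scontrolled (scontrolled_sum (index_enum 'I_n)
  (fun l => scontrolledM al0 (hy l) (scontrolled_partial i l j))) => r k.
rewrite gub_comp_dstar big_split /= addrC; congr (_ + _).
under eq_bigr do rewrite mulr_sumr.
rewrite exchange_big /=; apply: eq_bigr => m _; rewrite mulr_sumr.
by apply: eq_bigr => l _; ring.
Qed.

End LinearizedCoefficients.

Section LinearizedDrift.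
Variables (R : realType) (n K : nat) (f : 'cV[R]_n -> 'cV[R]_n).
Hypothesis hf : smooth f.
Variables (a b al : R) (Z : R -> 'cV[R]_K).
Hypothesis al0 : 0 < al.
Variables (x y : R -> 'cV[R]_n) (x' y' : R -> 'M[R]_(n, K)).
Hypothesis hx : forall i, scontrolled a b al Z (fun r => x r i 0) (fun r k => x' r i k).
Hypothesis hy : forall i, scontrolled a b al Z (fun r => y r i 0) (fun r k => y' r i k).

Lemma hoelder_partial i l : hoelder a b al (fun r => partial i f (x r) l 0).
Proof.
have hi := smooth_partial i hf.
refine (hoelder_comp al0 hx (smooth_has_partials l 0 hi) _).
by move=> m; apply: smooth_continuous_coord; exact: smooth_partial.
Qed.

Lemma hoelder_dapp l : hoelder a b al
  (fun r => on_pair (dapp f) (col_mx (x r) (y r)) l 0).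
Proof.
rewrite (_ : (fun r => _) =
  (fun r => \sum_i partial i f (x r) l 0 * y r i 0)); last first.
  by apply/funext => r; rewrite /on_pair col_mxKu col_mxKd mxE.
apply: hoelder_sum => i; apply: hoelderM => //; first exact: hoelder_partial.
by have [] := hy i.
Qed.

Lemma hoelder_dstar l : hoelder a b al
  (fun r => on_pair (dstar f) (col_mx (x r) (y r)) l 0).
Proof.
rewrite (_ : (fun r => _) =
  (fun r => \sum_i y r i 0 * partial l f (x r) i 0)); last first.
  by apply/funext => r; rewrite /on_pair col_mxKu col_mxKd mxE.
apply: hoelder_sum => i; apply: hoelderM => //; last exact: hoelder_partial.
by have [] := hy i.
Qed.

End LinearizedDrift.

(** * Conservation of the pairing *)

Lemma dapp_dstar_duality (R : realType) (n k : nat)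
    (phi : 'cV[R]_n -> 'M[R]_(n, k)) (q p v : 'cV[R]_n) j :
  \sum_l p l 0 * dapp phi q v l j = \sum_l v l 0 * dstar phi q p l j.
Proof.
by apply: (pairing_duality (D := fun i l j => partial i phi q l j)) => l j';
  rewrite mxE.
Qed.

Theorem corollary2p7 (R : realType) (N K : nat) (alpha t0 t1 : R)
    (halpha : 3^-1 < alpha <= 2^-1) (ht : t0 <= t1)
    (Z : R -> 'cV[R]_K) (ZZ : R -> R -> 'M[R]_K)
    (hZ : geometric_rough_path alpha t0 t1 Z ZZ)
    (f : 'cV[R]_N -> 'cV[R]_N) (hf : smooth f)
    (sigma : 'cV[R]_N -> 'M[R]_(N, K)) (hsigma : smooth sigma)
    (q p : R -> 'cV[R]_N)
    (hqp : adjoint_solution alpha t0 t1 Z ZZ f sigma q p)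
    (da : 'cV[R]_N) (dq : R -> 'cV[R]_N)
    (hdq : variational_solution alpha t0 t1 Z ZZ f sigma q da dq) :
  dotv (p t1) (dq t1) = dotv (p t0) (dq t0).
Proof.
have [a1 al2] := andP halpha.
have al0 : 0 < alpha by lra.
have al3 : 1 < 3 * alpha by lra.
have hq i := controlled_coord i (adj_q_controlled hqp).
have hp i := controlled_coord i (adj_p_controlled hqp).
have hv i := controlled_coord i (var_controlled hdq).
have adj_p_eq_flat t : t0 <= t -> t <= t1 -> exists2 J,
    is_rough_integral Z ZZ (fun r => on_pair (dstar sigma) (col_mx (q r) (p r)))
      (gub_comp (on_pair (dstar sigma)) (fun r => col_mx (q r) (p r))
        (fun r => col_mx (sigma (q r)) (- dstar sigma (q r) (p r)))) t t1 J &
    p t1 - p t = - (time_integral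
      (fun r => on_pair (dstar f) (col_mx (q r) (p r))) t t1 + J).
  move=> h0 h1; have [I [J hJ eI] e] := adj_p_eq hqp h0 h1.
  by exists J => //; rewrite e eI.
have Ev l := local_expansion_forward al0 al3 hZ al2
  (fun j => scontrolled_dapp hsigma al0 hq hv l j)
  (hoelder_dapp hf al0 hq hv l) (var_eq hdq).
have Ep l := local_expansion_backward al0 al3 hZ al2
  (fun j => scontrolled_dstar hsigma al0 hq hp l j)
  (hoelder_dstar hf al0 hq hp l) adj_p_eq_flat.
apply: (@hoelder_gt1_cst _ t0 t1 (3 * alpha) (fun r => dotv (p r) (dq r))) => //.
have onE m (phi : 'cV[R]_N -> 'cV[R]_N -> 'M[R]_(N, m)) x y :
    on_pair phi (col_mx x y) = phi x y by rewrite /on_pair col_mxKu col_mxKd.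
(* Av and Bp are the local approximations of the increments of dq and of -p,
   Az and Bz their first-level parts. *)
pose z s t j := Z t j 0 - Z s j 0.
pose F s l := dapp f (q s) (dq s) l 0; pose G s l := dstar f (q s) (p s) l 0.
pose A s l j := dapp sigma (q s) (dq s) l j.
pose B s l j := dstar sigma (q s) (p s) l j.
pose A' s k l j := gub_comp (on_pair (dapp sigma)) (fun r => col_mx (q r) (dq r))
  (fun r => col_mx (sigma (q r)) (dapp sigma (q r) (dq r))) s k l j.
pose B' s k l j := gub_comp (on_pair (dstar sigma)) (fun r => col_mx (q r) (p r))
  (fun r => col_mx (sigma (q r)) (- dstar sigma (q r) (p r))) s k l j.
pose Az s t l := \sum_j A s l j * z s t j.
pose Bz s t l := \sum_j B s l j * z s t j.
pose Av s t l := F s l * (t - s) + (Az s t l + \sum_k \sum_j A' s k l j * ZZ s t k j).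
pose Bp s t l := G s l * (t - s) + (Bz s t l + \sum_k \sum_j B' s k l j * ZZ s t k j).
have {}Ev l : bigO2 t0 t1 (3 * alpha) (fun s t => dq t l 0 - dq s l 0 - Av s t l).
  apply: eq_bigO2 (Ev l) => s t _ _ _; rewrite /germ onE.
  by under [X in (_ - (_ + (X + _)) = _)]eq_bigr do rewrite onE.
have {}Ep l : bigO2 t0 t1 (3 * alpha) (fun s t => p t l 0 - p s l 0 + Bp s t l).
  apply: eq_bigO2 (Ep l) => s t _ _ _; rewrite /germ onE.
  by under [X in (_ + (_ + (X + _)) = _)]eq_bigr do rewrite onE.
(* Expanding the increment of the pairing leaves p Av - dq Bp, and the product of
   the two increments contributes - Bz Az at leading order. *)
have cancel s t : t0 <= s -> s <= t -> t <= t1 ->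
    \sum_l (p s l 0 * Av s t l - dq s l 0 * Bp s t l - Bz s t l * Az s t l) = 0.
  move=> h0 h1 h2.
  apply: (@pairing_germ_cancels _ _ _ (fun l => p s l 0) (fun l => dq s l 0)
    (fun i l j => partial i sigma (q s) l j)
    (fun m i l j => partial m (partial i sigma) (q s) l j)
    (fun m k => sigma (q s) m k) (z s t)
    (fun k j => ZZ s t k j)) => [k j|l j|i j|k l j|k l j|].
  - exact: (geom_coord hZ k j h0 h1 h2).
  - by rewrite /A mxE.
  - by rewrite /B mxE.
  - by rewrite /A' gub_comp_dapp.
  - by rewrite /B' gub_comp_dstar //; under [X in _ + X]eq_bigr do rewrite mxE.
  - exact: dapp_dstar_duality.
have first_v l : bigO2 t0 t1 (2 * alpha) (fun s t => dq t l 0 - dq s l 0 - Az s t l).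
  by have [_ _] := hv l.
have first_p l : bigO2 t0 t1 (2 * alpha) (fun s t => p t l 0 - p s l 0 + Bz s t l).
  have [_ _ h] := hp l; apply: eq_bigO2 h => s t _ _ _; congr (_ + _).
  by rewrite -sumrN; apply: eq_bigr => j _; rewrite mxE mulNr opprK.
have inc_v l : hoelder t0 t1 alpha (fun r => dq r l 0) by have [] := hv l.
have inc_p l : hoelder t0 t1 alpha (fun r => p r l 0) by have [] := hp l.
have al20 : 0 < 2 * alpha by rewrite mulr_gt0.
have hBz l : bigO2 t0 t1 alpha (fun s t => Bz s t l).
  have w : alpha <= 2 * alpha by lra.
  apply: eq_bigO2 (bigO2B (bigO2_weaken al0 w (first_p l)) (inc_p l)).
  by move=> s t _ _ _ /=; ring.
have quad l : bigO2 t0 t1 (3 * alpha) (fun s t =>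
    (p t l 0 - p s l 0) * (dq t l 0 - dq s l 0) + Bz s t l * Az s t l).
  have e1 : 2 * alpha + alpha = 3 * alpha by ring.
  have e2 : alpha + 2 * alpha = 3 * alpha by ring.
  have := bigO2M (addr_gt0 al20 al0) (first_p l) (inc_v l); rewrite e1 => h1.
  have := bigO2M (addr_gt0 al0 al20) (hBz l) (first_v l); rewrite e2 => h2.
  by apply: eq_bigO2 (bigO2B h1 h2) => s t _ _ _; ring.
(* increment of p dq = p rem(dq) + dq rem(p) + quadratic error + cancelling part *)
have rem l := bigO2D (bigO2D (bigO2Ml (hoelder_bounded (ltW al0) (inc_p l)) (Ev l))
  (bigO2Ml (hoelder_bounded (ltW al0) (inc_v l)) (Ep l))) (quad l).
apply: eq_bigO2 (bigO2_sum (index_enum 'I_N) rem) => s t h0 h1 h2.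
rewrite -[LHS]addr0 -[X in _ + X](cancel s t h0 h1 h2) -big_split /dotv -sumrB /=.
by apply: eq_bigr => l _; ring.
Qed.
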